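(* Let $\mathcal{L}_Sf=p_{\mathrm s}^{-1}\nabla\cdot(p_{\mathrm s}D\nabla f)$ and $\mathcal{L}_Af=v_{\mathrm s}\cdot\nabla f$ be the symmetric and antisymmetric parts of the Markov generator $\mathcal{L}=b\cdot\nabla+\nabla\cdot D\nabla$ in $L^2(\mu)$, and let $k\in\mathbb{R}$. For $A\in\{\rho,J\}$ let $\widetilde{\mathcal{L}}_k^A=\frac12[\mathcal{L}_k^A+(\mathcal{L}_k^A)^\dagger]$ and $\widehat{\mathcal{L}}_k^A=\frac12[\mathcal{L}_k^A-(\mathcal{L}_k^A)^\dagger]$ denote the symmetric and antisymmetric parts in $L^2(\mu)$ of the tilted generators $$\mathcal{L}_k^\rho f=\mathcal{L}f+kVf,\qquad\mathcal{L}_k^Jf=\mathcal{L}f+k(b\cdot U+\nabla\cdot DU)f+2kU\cdot D\nabla f+k^2(U\cdot DU)f.$$ Then for $f\in D(\mathcal{L})$, $$\widetilde{\mathcal{L}}_k^\rho f=\mathcal{L}_Sf+kVf,\qquad\widehat{\mathcal{L}}_k^\rho f=\mathcal{L}_Af,$$ and $$\widetilde{\mathcal{L}}_k^Jf=\mathcal{L}_Sf+k(v_{\mathrm s}\cdot U)f+k^2(U\cdot DU)f,$$ $$\widehat{\mathcal{L}}_k^Jf=\mathcal{L}_Af+2k(DU)\cdot\nabla f+k\,p_{\mathrm s}^{-1}\nabla\cdot(p_{\mathrm s}DU)\,f.$$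
   Context: Setting. $b:\mathbb{R}^d\to\mathbb{R}^d$ is Lipschitz, $\sigma\in\mathbb{R}^{d\times m}$ is constant with $\sigma\sigma^\top>0$, $D=\frac12\sigma\sigma^\top$ (constant, symmetric, positive definite), and $\mathcal{L}=b\cdot\nabla+\nabla\cdot D\nabla$ is the $L^2(\mu)$-generator of the ergodic diffusion $dX_t=b(X_t)\,dt+\sigma\,dB_t$ on $\mathbb{R}^d$, whose unique invariant probability measure $\mu$ has a smooth, strictly positive density $p_{\mathrm s}$, $d\mu=p_{\mathrm s}\,dx$. The transition semigroup is strongly continuous on the real space $L^2(\mu)$; $\mathcal{L}$ and its adjoint have a common core containing the constants. $\dagger$ denotes the adjoint in $L^2(\mu)$ (computed by integration by parts against $d\mu$, boundary terms at infinity vanishing). $j_{\mathrm s}=b\,p_{\mathrm s}-D\nabla p_{\mathrm s}$ is divergence free, and $v_{\mathrm s}=j_{\mathrm s}/p_{\mathrm s}$, so $b=D\nabla\log p_{\mathrm s}+v_{\mathrm s}$. $V\in L^\infty(\mathbb{R}^d)$ and $U\in C_b^1(\mathbb{R}^d;\mathbb{R}^d)$ (bounded, continuously differentiable with bounded derivatives). $\mathcal{L}_k^\rho$ and $\mathcal{L}_k^J$ are the generators of the Feynman-Kac semigroups $f\mapsto\mathbb{E}^x[f(X_t)e^{k\int_0^tV(X_s)ds}]$ and $f\mapsto\mathbb{E}^x[f(X_t)e^{k\int_0^tU(X_s)\circ dX_s}]$ (Stratonovich integral). $\nabla\cdot DU$ means $\nabla\cdot(DU)=\sum_{ij}D_{ij}\partial_iU_j$.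 *)

(* Defs.v *)
From HB Require Import structures.
From mathcomp Require Import all_boot all_order all_algebra.
From mathcomp Require Import all_classical all_reals all_analysis.

Set Implicit Arguments.
Unset Strict Implicit.
Unset Printing Implicit Defensive.
Import Order.TTheory GRing.Theory Num.Theory.
Import numFieldNormedType.Exports.

Local Open Scope classical_set_scope.
Local Open Scope ring_scope.

(* R^d is the type 'rV[R]_d of row vectors with its Borel sigma-algebra. Since
   vectors are rows, the action of a matrix M on v is v *m M^T; for the
   symmetric matrix D this is v *m D. *)
HB.instance Definition _ (R : realType) (m n : nat) :=
  Measurable.copy 'M[R]_(m, n) (g_sigma_algebraType (@open 'M[R]_(m, n))).

Definition dotv (R : realType) (d : nat) (u v : 'rV[R]_d) : R :=
  \sum_(i < d) u 0 i * v 0 i.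

(* The measure that gives every half-open box its volume: Lebesgue measure. *)
Definition is_lebesgue (R : realType) (d : nat)
    (lam : {measure set 'rV[R]_d -> \bar R}) : Prop :=
  forall a b : 'rV[R]_d, (forall i, a 0 i <= b 0 i) ->
    lam [set x | forall i, a 0 i < x 0 i <= b 0 i]
      = (\prod_(i < d) (b 0 i - a 0 i))%:E.

Section classical_calculus.
Context {R : realType} {d : nat}.
Implicit Types (f : 'rV[R]_d -> R) (F : 'rV[R]_d -> 'rV[R]_d).

Definition partial (i : 'I_d) f (x : 'rV[R]_d) : R := 'D_(delta_mx 0 i) f x.

Definition grad f (x : 'rV[R]_d) : 'rV[R]_d := \row_i partial i f x.

Definition div F (x : 'rV[R]_d) : R :=
  \sum_(i < d) partial i (fun y => F y 0 i) x.

Fixpoint Cclass (n : nat) f : Prop :=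
  continuous f /\
  if n is n'.+1 then
    forall i, (forall x, derivable f x (delta_mx 0 i)) /\
              Cclass n' (partial i f)
  else True.

Definition smooth f : Prop := forall n, Cclass n f.

Definition bounded f : Prop := exists M : R, forall x, `|f x| <= M.

Definition Cb1 f : Prop :=
  [/\ Cclass 1 f, bounded f & forall i, bounded (partial i f)].

Definition Cc (n : nat) f : Prop :=
  Cclass n f /\ compact (closure [set x | f x != 0]).

End classical_calculus.

(* Functions in D(L) are differentiated in the sense of distributions with
   respect to Lebesgue measure lam. The total functions wgrad and wdiv return
   locally integrable representatives, which are unique up to null sets, and
   are arbitrary where no weak derivative exists. *)
Section weak_calculus.
Context {R : realType} {d : nat} (lam : {measure set 'rV[R]_d -> \bar R}).
Implicit Types (f g h : 'rV[R]_d -> R) (F : 'rV[R]_d -> 'rV[R]_d).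

Definition loc_integrable f : Prop :=
  measurable_fun setT f /\
  forall K : set 'rV[R]_d, compact K -> lam.-integrable K (EFin \o f).

Definition is_weak_partial (i : 'I_d) f g : Prop :=
  [/\ loc_integrable f, loc_integrable g &
    forall phi, Cc 1 phi ->
      \int[lam]_x (f x * partial i phi x) = - \int[lam]_x (g x * phi x)].

Definition is_weak_div F h : Prop :=
  [/\ forall i, loc_integrable (fun x => F x 0 i), loc_integrable h &
    forall phi, Cc 1 phi ->
      \int[lam]_x (dotv (F x) (grad phi x)) = - \int[lam]_x (h x * phi x)].

Definition weak_partial (i : 'I_d) f : 'rV[R]_d -> R :=
  xget (cst 0) [set g | is_weak_partial i f g].

Definition wgrad f (x : 'rV[R]_d) : 'rV[R]_d := \row_i weak_partial i f x.

Definition wdiv F : 'rV[R]_d -> R := xget (cst 0) [set h | is_weak_div F h].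

End weak_calculus.

(* Unbounded operators on L^2(mu) are represented by their graphs, on functions
   rather than on classes modulo mu-null sets. *)
Section L2_operators.
Context {R : realType} {d : nat} (mu : {measure set 'rV[R]_d -> \bar R}).
Implicit Types (f g h : 'rV[R]_d -> R) (S : R -> ('rV[R]_d -> R) -> 'rV[R]_d -> R)
  (G : ('rV[R]_d -> R) -> ('rV[R]_d -> R) -> Prop).

Definition L2 f : Prop := f \in Lfun mu 2%:E.

Definition L2dist f g : \bar R := Lnorm mu 2%:E (EFin \o (f \- g)).

Definition strongly_continuous S : Prop :=
  forall f, L2 f -> L2dist (S t f) f @[t --> 0^'+] --> 0%E.

Definition generator S f h : Prop :=
  [/\ L2 f, L2 h &
    L2dist (fun x => (S t f x - f x) / t) h @[t --> 0^'+] --> 0%E].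

Definition domain G f : Prop := exists h, G f h.

Definition adjoint G f h : Prop :=
  [/\ L2 f, L2 h &
    forall g Gg, G g Gg ->
      \int[mu]_x (Gg x * f x) = \int[mu]_x (g x * h x)].

Definition is_core G (C : set ('rV[R]_d -> R)) : Prop :=
  (forall f, C f -> domain G f) /\
  forall f h, G f h ->
    exists u w : nat -> 'rV[R]_d -> R,
      [/\ forall n, C (u n) /\ G (u n) (w n),
          L2dist (u n) f @[n --> \oo] --> 0%E &
          L2dist (w n) h @[n --> \oo] --> 0%E].

End L2_operators.

Section diffusion.
Context {R : realType} {d m : nat} {dO : measure_display}
  {Om : measurableType dO} (P : probability Om R).

(* Standard m-dimensional Brownian motion: the coordinates of the increments
   over consecutive time intervals are independent centred Gaussians. Note that
   the second parameter of normal_prob is the standard deviation. *)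
Definition is_brownian (B : R -> Om -> 'rV[R]_m) : Prop :=
  [/\ forall t, measurable_fun setT (B t),
      {ae P, forall w, B 0 w = 0 /\ {within `[0, +oo[, continuous (B ^~ w)}} &
      forall (n : nat) (t : nat -> R) (A : 'I_n -> 'I_m -> set R),
        0 <= t 0%N -> (forall i, t i < t i.+1) ->
        (forall i j, measurable (A i j)) ->
        P [set w | forall i j, A i j ((B (t i.+1) w - B (t i) w) 0 j)]
          = (\prod_(i < n) \prod_(j < m)
               fine (normal_prob 0 (Num.sqrt (t i.+1 - t i)) (A i j)))%:E].

(* X x is the solution started at x of dX_t = b(X_t) dt + sigma dB_t. As sigma
   is constant this is a pathwise integral equation. *)
Definition is_diffusion (b : 'rV[R]_d -> 'rV[R]_d) (sigma : 'M[R]_(d, m))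
    (B : R -> Om -> 'rV[R]_m) (X : 'rV[R]_d -> R -> Om -> 'rV[R]_d) : Prop :=
  (forall x t, measurable_fun setT (X x t)) /\
  forall x, {ae P, forall w,
    {within `[0, +oo[, continuous (fun t => X x t w)} /\
    forall t, 0 <= t ->
      X x t w = x
        + \row_i (\int[lebesgue_measure]_(s in `[0, t]) (b (X x s w) 0 i))
        + B t w *m sigma^T}.

Definition transition (X : 'rV[R]_d -> R -> Om -> 'rV[R]_d) (t : R)
    (f : 'rV[R]_d -> R) (x : 'rV[R]_d) : R :=
  \int[P]_w f (X x t w).

Definition invariant (X : 'rV[R]_d -> R -> Om -> 'rV[R]_d)
    (mu : probability 'rV[R]_d R) : Prop :=
  forall t (A : set 'rV[R]_d), 0 <= t -> measurable A ->
    (\int[mu]_x P (X x t @^-1` A) = mu A)%E.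

Definition unique_invariant (X : 'rV[R]_d -> R -> Om -> 'rV[R]_d)
    (mu : probability 'rV[R]_d R) : Prop :=
  invariant X mu /\
  forall nu : probability 'rV[R]_d R, invariant X nu ->
    forall A : set 'rV[R]_d, measurable A -> nu A = mu A.

End diffusion.

Section operators.
Context {R : realType} {d : nat} (lam : {measure set 'rV[R]_d -> \bar R}).
Implicit Types (f h : 'rV[R]_d -> R) (p V : 'rV[R]_d -> R)
  (b U v : 'rV[R]_d -> 'rV[R]_d) (D : 'M[R]_d).

Definition positive_definite D : Prop :=
  forall v : 'rV[R]_d, v != 0 -> 0 < dotv (v *m D) v.

Definition current D b p (x : 'rV[R]_d) : 'rV[R]_d :=
  p x *: b x - grad p x *m D.

Definition velocity D b p (x : 'rV[R]_d) : 'rV[R]_d :=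
  (p x)^-1 *: current D b p x.

Definition diff_op D b f (x : 'rV[R]_d) : R :=
  dotv (b x) (wgrad lam f x) + wdiv lam (fun y => wgrad lam f y *m D) x.

(* For f in the domain of the generator of the diffusion, the two weak
   derivatives in diff_op exist by elliptic regularity (W^{2,2}_loc). *)
Definition diff_op_defined D f : Prop :=
  (forall i, exists g, is_weak_partial lam i f g) /\
  (exists h, is_weak_div lam (fun y => wgrad lam f y *m D) h).

(* The statement that the operator with graph G acts as
   b . grad + div (D grad), test functions belonging to its domain. *)
Definition acts_as_diff_op D b (G : ('rV[R]_d -> R) -> ('rV[R]_d -> R) -> Prop) :
    Prop :=
  (forall g, Cc 2 g -> domain G g) /\
  (forall f h, G f h ->
     diff_op_defined D f /\ {ae lam, forall x, h x = diff_op D b f x}).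

Definition sym_op D p f (x : 'rV[R]_d) : R :=
  (p x)^-1 * wdiv lam (fun y => p y *: (wgrad lam f y *m D)) x.

Definition antisym_op D b p f (x : 'rV[R]_d) : R :=
  dotv (velocity D b p x) (wgrad lam f x).

Definition tilted_rho D b V (k : R) f (x : 'rV[R]_d) : R :=
  diff_op D b f x + k * V x * f x.

Definition tilted_J D b U (k : R) f (x : 'rV[R]_d) : R :=
  diff_op D b f x
  + k * (dotv (b x) (U x) + div (fun y => U y *m D) x) * f x
  + 2 * k * dotv (U x) (wgrad lam f x *m D)
  + k ^+ 2 * dotv (U x) (U x *m D) * f x.

End operators.

(* Adjoint and symmetric/antisymmetric parts of a differential operator T
   defined on the domain dom. T need not map dom into L^2(mu) when b is
   unbounded, and an element f of dom need not belong to the domain of the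
   Hilbert space adjoint. The adjoint "computed by integration by parts" against
   test functions always makes sense; it extends the Hilbert space adjoint of
   every operator in L^2(mu) that agrees with T on test functions, and it is
   unique up to null sets. *)
Section adjoints.
Context {R : realType} {d : nat} (lam mu : {measure set 'rV[R]_d -> \bar R}).
Variable dom : set ('rV[R]_d -> R).
Variable T : ('rV[R]_d -> R) -> 'rV[R]_d -> R.
Implicit Types f h S A : 'rV[R]_d -> R.

Definition L2_graph f h : Prop :=
  [/\ dom f, L2 mu h & {ae mu, forall x, h x = T f x}].

Definition ibp_adjoint f h : Prop :=
  loc_integrable lam h /\
  forall g, Cc 2 g ->
    \int[mu]_x (T g x * f x) = \int[mu]_x (g x * h x).

(* At f, the adjoint exists, and (T f + T^dagger f) / 2 = S and
   (T f - T^dagger f) / 2 = A; the same for the Hilbert space adjoint when f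
   belongs to its domain. *)
Definition has_parts f S A : Prop :=
  (exists h, ibp_adjoint f h) /\
  forall h, ibp_adjoint f h \/ adjoint mu L2_graph f h ->
    {ae mu, forall x, 2^-1 * (T f x + h x) = S x} /\
    {ae mu, forall x, 2^-1 * (T f x - h x) = A x}.

End adjoints.

(* Main.v *)
Require Import Defs.
From HB Require Import structures.
From mathcomp Require Import all_boot all_order all_algebra.
From mathcomp Require Import all_classical all_reals all_analysis.
From mathcomp Require Import measurable_realfun ess_sup_inf ring lra.

Set Implicit Arguments.
Unset Strict Implicit.
Unset Printing Implicit Defensive.
Import Order.TTheory GRing.Theory Num.Theory.
Import numFieldNormedType.Exports.

Local Open Scope classical_set_scope.
Local Open Scope ring_scope.

(** Writing the drift as b = D grad log p + v, with p v the stationary current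
j, splits the generator L into the operator S0 f = p^-1 div (p D grad f), which
is symmetric for dmu = p dx, and A0 f = v . grad f, which is antisymmetric
because div j = 0. Both tilted generators have the form
  T f = L f + q f + 2 W . grad f
with W continuously differentiable and q locally bounded: W = 0, q = k V for the
one, and W = k D U, q = k (b . U + div (D U)) + k^2 U . D U for the other.
Integrating by parts against mu turns 2 W . grad f into
- 2 W . grad f - 2 p^-1 div (p W) f, so that the symmetric part of T is
S0 f + (q - p^-1 div (p W)) f and the antisymmetric part is
A0 f + 2 W . grad f + p^-1 div (p W) f (lemma perturbed_has_parts). The theorem
is the evaluation of these formulas for the two choices of W and q.

Since f has only weak derivatives, the adjoint is tested against functions g of
class C^2 with compact support. The difference (T g) f p - g (S f - A f) p is,
almost everywhere, a sum of four expressions: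
  f j . grad g + g j . grad f,
  f div (p D grad g) + grad f . p D grad g,
  - (p D grad f . grad g + div (p D grad f) g),
  2 (f div (g p W) + grad f . g p W),
each of which has integral zero (lemma perturbed_ibp). For the last three this
is the definition of the weak derivatives of f. The first one is the delicate
one: b is merely Lipschitz, so g j is not an admissible test field for the weak
gradient of f. One replaces j by its average J against a smooth kernel. The
field J is continuously differentiable, and div J at x is the weak divergence of
j tested against the kernel centred at x, hence zero. Testing with g J gives the
identity for J, and the kernel then shrinks to a point (lemma
null_int_stationary).

The adjoint is unique by the fundamental lemma of the calculus of variations.
An element of the Hilbert space adjoint satisfies the same tested identity
because T maps test functions to square-integrable functions (lemma
adjoint_ibp_adjoint).

Lebesgue measure is only given by the volumes of boxes. These generate the Borel
sets, so the measure is invariant under translations; differentiating the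
integral of a translate of phi then shows that partial derivatives of compactly
supported functions have integral zero, and Fubini's theorem is avoided
throughout. *)

(** * Borel sets of R^d and translation invariance of Lebesgue measure *)

Section borel_sets_of_rV.
Context {R : realType} {d : nat}.
Implicit Types (a b x y v : 'rV[R]_d) (A K : set 'rV[R]_d).

Lemma open_measurable_rV A : open A -> measurable A.
Proof. exact: sub_sigma_algebra. Qed.

Lemma closed_measurable_rV A : closed A -> measurable A.
Proof.
move=> cA; rewrite -(setCK A); apply: measurableC.
by apply: open_measurable_rV; rewrite openC.
Qed.

Lemma compact_measurable_rV K : compact K -> measurable K.
Proof.
move=> cK; apply: closed_measurable_rV.
exact: (compact_closed (@norm_hausdorff R 'rV[R]_d)).
Qed.

Lemma continuous_measurable_rV (f : 'rV[R]_d -> R) :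
  continuous f -> measurable_fun setT f.
Proof.
move=> /continuousP cf mD; apply: (measurability _ (RGenOpens.measurableE R)) => //.
move=> _ [_ [a [c ->]] <-]; rewrite setTI.
apply: open_measurable_rV; apply: cf; exact: interval_open.
Qed.

Lemma shift_continuous v : continuous (fun x => x + v).
Proof.
move=> x; exact: (@cvgD R 'rV[R]_d 'rV[R]_d (nbhs x) _ id (cst v) x v
  (@cvg_id _ _) (@cvg_cst _ _ _ _ _)).
Qed.

Lemma shift_measurable v : measurable_fun setT (fun x => x + v).
Proof.
move=> mD; apply: (@measurability _ _ _ _ setT _ (@open 'rV[R]_d)) => //.
move=> _ [B oB <-]; rewrite setTI; apply: open_measurable_rV.
by move/continuousP: (@shift_continuous v); exact.
Qed.

Definition open_box a b := [set x : 'rV[R]_d | forall i, a 0 i < x 0 i < b 0 i].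
Definition half_open_box a b :=
  [set x : 'rV[R]_d | forall i, a 0 i < x 0 i <= b 0 i].
Definition closed_box a b :=
  [set x : 'rV[R]_d | forall i, a 0 i <= x 0 i <= b 0 i].

Lemma closed_box_compact a b : compact (closed_box a b).
Proof.
have := @rV_compact R d (fun i => `[a 0 i, b 0 i]%classic)
  (fun i => @segment_compact R _ _).
by congr compact; apply/seteqP; split => x /= h i; have := h i; rewrite in_itv.
Qed.

Lemma closed_box_measurable a b : measurable (closed_box a b).
Proof. by apply: compact_measurable_rV; exact: closed_box_compact. Qed.

Lemma open_box_closed_box a b : open_box a b `<=` closed_box a b.
Proof. by move=> x h i; have /andP[/ltW -> /ltW ->] := h i. Qed.

Lemma open_box_open a b : open (open_box a b).
Proof.
rewrite openE => x xab.
have h i : nbhs x [set y : 'rV[R]_d | a 0 i < y 0 i < b 0 i].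
  have : \forall z \near x 0 i, z \in `]a 0 i, b 0 i[.
    by apply: near_in_itvoo; rewrite in_itv /= xab.
  move=> /(@coord_continuous R 1 d 0 i x).
  apply: (@filterS _ (nbhs (x : 'rV[R]_d)) _) => z /=.
  by rewrite in_itv.
exact: (filter_forall _ h).
Qed.

Lemma open_box_measurable a b : measurable (open_box a b).
Proof. by apply: open_measurable_rV; exact: open_box_open. Qed.

Lemma half_open_box_measurable a b : measurable (half_open_box a b).
Proof.
rewrite (_ : half_open_box a b = \bigcap_(i in [set: 'I_d])
    ((fun x : 'rV[R]_d => x 0 i) @^-1` `]a 0 i, b 0 i]%classic)).
  apply: fin_bigcap_measurable => // i _; rewrite -[X in measurable X]setTI.
  exact: (continuous_measurable_rV (@coord_continuous R 1 d 0 i)).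
apply/seteqP; split => x /= h i; first by move=> _; rewrite /= in_itv; exact: h.
by have := h i I; rewrite /= in_itv.
Qed.

Lemma ball_rV x y e : (forall i, `|x 0 i - y 0 i| < e) -> 0 < e -> ball x e y.
Proof. by move=> xy e0; split => // i j; rewrite ord1; exact: xy. Qed.

Lemma open_ball_rV A x : open A -> A x ->
  exists2 e, 0 < e & forall y, (forall i, `|x 0 i - y 0 i| < e) -> A y.
Proof.
move=> oA Ax; have /nbhs_ballP[e e0 eA] : nbhs x A by exact: open_nbhs_nbhs.
by exists e => // y xy; apply: eA; exact: ball_rV.
Qed.

(** Every open set is the union of the boxes with rational corners that it
contains, and there are countably many of these. *)
Lemma boxes_generate (box : 'rV[R]_d -> 'rV[R]_d -> set 'rV[R]_d) :
  (forall a b, open_box a b `<=` box a b) ->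
  (forall a b, box a b `<=` closed_box a b) ->
  (forall a b, measurable (box a b)) ->
  measurable = <<s [set box ab.1 ab.2 | ab in setT] >>.
Proof.
move=> obox cbox mbox; set G := image _ _.
apply/seteqP; split; last first.
  apply: smallest_sub; first exact: sigma_algebra_measurable.
  by move=> _ [[a b] _ <-].
apply: smallest_sub; first exact: smallest_sigma_algebra.
move=> A oA.
pose q2r (q : 'rV[rat]_d) : 'rV[R]_d := map_mx ratr q.
pose F (q : 'rV[rat]_d * 'rV[rat]_d) : set 'rV[R]_d :=
  if `[< box (q2r q.1) (q2r q.2) `<=` A >] then box (q2r q.1) (q2r q.2) else set0.
have -> : A = \bigcup_q F q.
  apply/seteqP; split=> [x Ax|x [q _]]; last first.
    by rewrite /F; case: asboolP => [sub /sub|_ []].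
  have [e e0 eA] := open_ball_rV oA Ax.
  have xl i : x 0 i - e / 2 < x 0 i by rewrite ltrBlDr ltrDl divr_gt0.
  have xr i : x 0 i < x 0 i + e / 2 by rewrite ltrDl divr_gt0.
  have /choice[p pP] i := rat_in_itvoo (xl i).
  have /choice[r rP] i := rat_in_itvoo (xr i).
  exists (\row_i p i, \row_i r i) => //; rewrite /F /=.
  have xbox : box (q2r (\row_i p i)) (q2r (\row_i r i)) x.
    apply: obox => i; rewrite !mxE.
    have := pP i; have := rP i; rewrite !in_itv /=.
    by move=> /andP[-> _] /andP[_ ->].
  case: asboolP => // nsub; exfalso; apply: nsub => y /cbox ybox.
  apply: eA => i; have := ybox i; rewrite !mxE.
  have := pP i; have := rP i; rewrite !in_itv /= ltr_norml.
  by move=> *; lra.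
apply: (@countable_bigcupT_measurable _ (g_sigma_algebraType G)) => //.
move=> q; rewrite /F; case: asboolP => // _.
by apply: sub_sigma_algebra; exists (q2r q.1, q2r q.2).
Qed.

Lemma half_open_boxI a b a' b' : half_open_box a b `&` half_open_box a' b' =
  half_open_box (\row_i Num.max (a 0 i) (a' 0 i)) (\row_i Num.min (b 0 i) (b' 0 i)).
Proof.
apply/seteqP; split=> [x [/= h h'] i|x /= h].
  have := h i; have := h' i; rewrite !mxE gt_max le_min.
  by move=> /andP[-> ->] /andP[-> ->].
split => i; have := h i; rewrite !mxE gt_max le_min;
  by move=> /andP[/andP[h1 h2] /andP[h3 h4]]; rewrite ?h1 ?h2 ?h3 ?h4.
Qed.

Lemma open_boxI a b a' b' : open_box a b `&` open_box a' b' =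
  open_box (\row_i Num.max (a 0 i) (a' 0 i)) (\row_i Num.min (b 0 i) (b' 0 i)).
Proof.
apply/seteqP; split=> [x [/= h h'] i|x /= h].
  have := h i; have := h' i; rewrite !mxE gt_max lt_min.
  by move=> /andP[-> ->] /andP[-> ->].
split => i; have := h i; rewrite !mxE gt_max lt_min;
  by move=> /andP[/andP[h1 h2] /andP[h3 h4]]; rewrite ?h1 ?h2 ?h3 ?h4.
Qed.

Lemma le_coord_norm x i : `|x 0 i| <= `|x|.
Proof.
rewrite [leRHS]/Num.Def.normr /= mx_normrE; apply/bigmax_geP; right => /=.
by exists (0, i).
Qed.

Definition cube (n : R) : set 'rV[R]_d := closed_box (const_mx (- n)) (const_mx n).

Lemma cubeE n x : cube n x <-> forall i, `|x 0 i| <= n.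
Proof. by split=> h i; have := h i; rewrite !mxE ler_norml. Qed.

Lemma norm_cube n x : `|x| <= n -> cube n x.
Proof. by move=> xn; apply/cubeE => i; exact: le_trans (le_coord_norm _ _) xn. Qed.

Lemma compact_sub_cube K : compact K -> exists2 n, 0 < n & K `<=` cube n.
Proof.
move=> /compact_bounded[M [_ MK]]; exists (`|M| + 1); first by rewrite ltr_pwDr.
by move=> x Kx; apply: norm_cube; apply: MK => //; rewrite ltr_pwDr // ler_norm.
Qed.

End borel_sets_of_rV.

Section lebesgue_measure_of_rV.
Context {R : realType} {d : nat} (lam : {measure set 'rV[R]_d -> \bar R}).
Hypothesis hlam : is_lebesgue lam.
Implicit Types (a b x v : 'rV[R]_d) (A K : set 'rV[R]_d).

Lemma half_open_box_lty a b : (lam (half_open_box a b) < +oo)%E.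
Proof.
have [ab|nab] := pselect (forall i, a 0 i <= b 0 i); first by rewrite hlam ?ltry.
rewrite (_ : half_open_box a b = set0) ?measure0// -subset0 => x /= h.
by apply: nab => i; have /andP[/ltW + ?] := h i; move/le_trans; exact.
Qed.

Lemma compact_lty K : compact K -> (lam K < +oo)%E.
Proof.
move=> /[dup] cK /compact_sub_cube[n n0 Kn].
apply: le_lt_trans (half_open_box_lty (const_mx (- (n + 1))) (const_mx n)).
apply: le_measure; rewrite ?inE.
- exact: compact_measurable_rV.
- exact: half_open_box_measurable.
- move=> x /Kn h i; have := h i; rewrite !mxE => /andP[xl ->]; rewrite andbT.
  by rewrite (lt_le_trans _ xl)// ltrN2 ltrDl.
Qed.

(** The translate of a half-open box is a half-open box of the same volume. *)
Lemma lebesgue_shift v A : measurable A ->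
  lam ((fun x => x + v) @^-1` A) = lam A.
Proof.
move=> mA; have mv := shift_measurable v.
pose hob (n : nat) : set 'rV[R]_d :=
  half_open_box (const_mx (- n%:R)) (const_mx n%:R).
have hoc a b : half_open_box a b `<=` closed_box a b.
  by move=> x h i; have /andP[/ltW -> ->] := h i.
have oho a b : open_box a b `<=` half_open_box a b.
  by move=> x h i; have /andP[-> /ltW ->] := h i.
symmetry; apply: (@measure_unique _ _ _
   [set half_open_box ab.1 ab.2 | ab in setT] hob _ _ _ _ lam
   (pushforward lam (fun x => x + v)) _ _ A mA).
- exact: boxes_generate oho hoc half_open_box_measurable.
- move=> _ _ [[a b] _ <-] [[a' b'] _ <-]; rewrite half_open_boxI.
  by exists (\row_i Num.max (a 0 i) (a' 0 i), \row_i Num.min (b 0 i) (b' 0 i)).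
- by move=> n; exists (const_mx (- n%:R), const_mx n%:R).
- rewrite -subTset => /= x _; have xn := archi_boundP (normr_ge0 (x : 'rV[R]_d)).
  exists (Num.bound `|x : 'rV[R]_d|) => // i; rewrite !mxE.
  have := le_lt_trans (le_coord_norm x i) xn.
  by rewrite ltr_norml => /andP[-> /ltW].
- move=> _ [[a b] _ <-] /=; rewrite /pushforward.
  rewrite (_ : _ @^-1` _ = half_open_box (a - v) (b - v)); last first.
    by apply/seteqP; split => x /= h i; have := h i; rewrite !mxE ltrBlDr lerBrDr.
  have [ab|nab] := pselect (forall i, a 0 i <= b 0 i).
    rewrite hlam// hlam; last by move=> i; rewrite !mxE lerB.
    by congr EFin; apply: eq_bigr => i _; rewrite !mxE; ring.
  have h0 (a' b' : 'rV[R]_d) : ~ (forall i, a' 0 i <= b' 0 i) ->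
      half_open_box a' b' = set0.
    move=> nab'; rewrite -subset0 => x /= h.
    by apply: nab' => i; have /andP[/ltW + ?] := h i; move/le_trans; exact.
  rewrite !h0// => h; apply: nab => i; have := h i.
  by rewrite !mxE lerD2r.
- by move=> n; exact: half_open_box_lty.
Qed.

End lebesgue_measure_of_rV.

(** * Functions of class C^n *)

Section calculus_of_Cclass.
Context {R : realType} {d : nat}.
Implicit Types (f g : 'rV[R]_d -> R) (x : 'rV[R]_d).

Lemma continuous_D f g : continuous f -> continuous g ->
  continuous (fun x => f x + g x).
Proof. by move=> cf cg x; exact: (@continuousD R R^o _ f g x (cf x) (cg x)). Qed.

Lemma continuous_M f g : continuous f -> continuous g ->
  continuous (fun x => f x * g x).
Proof. by move=> cf cg x; exact: (@continuousM R _ f g x (cf x) (cg x)). Qed.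

Lemma continuous_V f : (forall x, f x != 0) -> continuous f ->
  continuous (fun x => (f x)^-1).
Proof. by move=> f0 cf x; exact: (@continuousV R _ f x (f0 x) (cf x)). Qed.

Lemma Cclass_continuous n f : Cclass n f -> continuous f.
Proof. by case: n => [|n] []. Qed.

Lemma Cclass_derivable n f i x : Cclass n.+1 f -> derivable f x (delta_mx 0 i).
Proof. by move=> [_ /(_ i)[]]. Qed.

Lemma Cclass_partial n f i : Cclass n.+1 f -> Cclass n (partial i f).
Proof. by move=> [_ /(_ i)[]]. Qed.

Lemma CclassS n f : Cclass n.+1 f -> Cclass n f.
Proof.
elim: n f => [|n IH] f [cf df]; split => // i; have [dfi Cf] := df i.
by split => //; exact: IH.
Qed.

Lemma Cclass1 n f : Cclass n.+1 f -> Cclass 1 f.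
Proof. by elim: n => // n IH /CclassS. Qed.

Lemma Cclass_cst n (c : R) : Cclass n (fun _ : 'rV[R]_d => c).
Proof.
elim: n c => [|n IH] c; split => //; try exact: cst_continuous.
move=> i; split => [x|]; first exact: derivable_cst.
rewrite (_ : partial i _ = fun=> 0)//.
by apply/funext => x; exact: derive_cst.
Qed.

Lemma partialD f g i x : derivable f x (delta_mx 0 i) ->
  derivable g x (delta_mx 0 i) ->
  partial i (fun y => f y + g y) x = partial i f x + partial i g x.
Proof. exact: deriveD. Qed.

Lemma partialM f g i x : derivable f x (delta_mx 0 i) ->
  derivable g x (delta_mx 0 i) ->
  partial i (fun y => f y * g y) x = partial i f x * g x + f x * partial i g x.
Proof.
move=> df dg; rewrite /partial (deriveM df dg) addrC mulrC.
by congr (_ + _); exact: mulrC.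
Qed.

Lemma partialV f i x : f x != 0 -> derivable f x (delta_mx 0 i) ->
  partial i (fun y => (f y)^-1) x = - (f x)^-1 ^+ 2 * partial i f x.
Proof. by move=> fx df; rewrite /partial (deriveV fx df) exprVn. Qed.

Lemma partialZ f i x (c : R) : derivable f x (delta_mx 0 i) ->
  partial i (fun y => c * f y) x = c * partial i f x.
Proof. by move=> df; rewrite /partial (deriveZ c df). Qed.

Lemma CclassD n f g : Cclass n f -> Cclass n g -> Cclass n (fun x => f x + g x).
Proof.
elim: n f g => [|n IH] f g Cf Cg; split => //.
- exact: (continuous_D (Cclass_continuous Cf) (Cclass_continuous Cg)).
- exact: (continuous_D (Cclass_continuous Cf) (Cclass_continuous Cg)).
move=> i; have df := @Cclass_derivable n f i ^~ Cf.
have dg := @Cclass_derivable n g i ^~ Cg.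
split=> [x|]; first exact: derivableD.
rewrite (_ : partial i _ = fun x => partial i f x + partial i g x).
  by apply: IH; exact: Cclass_partial.
by apply/funext => x; exact: partialD.
Qed.

Lemma CclassM n f g : Cclass n f -> Cclass n g -> Cclass n (fun x => f x * g x).
Proof.
elim: n f g => [|n IH] f g Cf Cg; split => //.
- exact: (continuous_M (Cclass_continuous Cf) (Cclass_continuous Cg)).
- exact: (continuous_M (Cclass_continuous Cf) (Cclass_continuous Cg)).
move=> i; have df := @Cclass_derivable n f i ^~ Cf.
have dg := @Cclass_derivable n g i ^~ Cg.
split=> [x|]; first exact: derivableM.
rewrite (_ : partial i _ = fun x => partial i f x * g x + f x * partial i g x).
  by apply: CclassD; apply: IH; (exact: Cclass_partial || exact: CclassS).
by apply/funext => x; exact: partialM.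
Qed.

Lemma CclassZ n f (c : R) : Cclass n f -> Cclass n (fun x => c * f x).
Proof. by move=> Cf; apply: CclassM => //; exact: Cclass_cst. Qed.

Lemma CclassV n f : (forall x, f x != 0) -> Cclass n f ->
  Cclass n (fun x => (f x)^-1).
Proof.
move=> f0; elim: n f f0 => [|n IH] f f0 Cf; split => //.
- exact: (continuous_V f0 (Cclass_continuous Cf)).
- exact: (continuous_V f0 (Cclass_continuous Cf)).
move=> i; have df := @Cclass_derivable n f i ^~ Cf.
split=> [x|]; first exact: derivableV.
rewrite (_ : partial i _ = fun x => (-1 * ((f x)^-1 * (f x)^-1)) * partial i f x).
  apply: CclassM; last exact: Cclass_partial.
  by apply: CclassZ; apply: CclassM; apply: IH => //; exact: CclassS.
by apply/funext => x; rewrite partialV// mulN1r expr2.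
Qed.

Lemma Cclass_sum n m (F : 'I_m -> 'rV[R]_d -> R) : (forall i, Cclass n (F i)) ->
  Cclass n (fun x => \sum_i F i x).
Proof.
move=> CF; elim: m F CF => [|m IH] F CF.
  under eq_fun do rewrite big_ord0; exact: Cclass_cst.
by under eq_fun do rewrite big_ord_recl; apply: CclassD => //; exact: IH.
Qed.

Lemma Cclass_prod n m (F : 'I_m -> 'rV[R]_d -> R) : (forall i, Cclass n (F i)) ->
  Cclass n (fun x => \prod_i F i x).
Proof.
move=> CF; elim: m F CF => [|m IH] F CF.
  under eq_fun do rewrite big_ord0; exact: Cclass_cst.
by under eq_fun do rewrite big_ord_recl; apply: CclassM => //; exact: IH.
Qed.

(** The positive part becomes of class C^(n-1) when raised to the power n. *)
Definition pospow (n : nat) (t : R) : R := Num.max t 0 ^+ n.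

Lemma pospow_continuous n : continuous (pospow n).
Proof.
move=> t.
have h : continuous (fun t : R => Num.max t 0).
  move=> {}t.
  exact: (@continuous_max R R id (cst 0) t (@cvg_id _ _) (@cvg_cst _ _ _ _ _)).
exact: (continuous_comp (h t) (@exprn_continuous R n _)).
Qed.

Lemma pospow_derive n (t : R) :
  is_derive t 1 (pospow n.+2) (n.+2%:R * pospow n.+1 t).
Proof.
have [t0|t0|->] := ltgtP t 0.
- apply: (@near_eq_is_derive _ _ _ (cst 0)).
    near=> s; rewrite /pospow max_r ?expr0n//.
    by apply/ltW; near: s; exact: lt_nbhsl.
  by rewrite /pospow max_r ?ltW// expr0n mulr0; exact: is_derive_cst.
- apply: (@near_eq_is_derive _ _ _ (fun s : R => s ^+ n.+2)).
    near=> s; rewrite /pospow max_l//.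
    by apply/ltW; near: s; exact: lt_nbhsr.
  rewrite /pospow max_l ?ltW//.
  by apply: DeriveDef; [exact: exprn_derivable|rewrite exp_derive scaler1].
have h : (fun h : R => h^-1 *:
    ((pospow n.+2 \o shift 0) (h *: (1 : R)) - pospow n.+2 0)) @ 0^' -->
    (0 : R).
  apply: (@cvg_trans _ (pospow n.+1 @ 0^')).
    apply: near_eq_cvg; near=> s.
    rewrite /pospow /= addr0 scaler1 maxxx expr0n subr0.
    have s0 : s != 0.
      by near: s; exact: nbhs_dnbhs_neq.
    have [sp|sn] := leP s 0; first by rewrite !expr0n scaler0.
    by rewrite [s ^+ n.+2]exprS [_ *: _]mulrA mulVf// mul1r.
  have E0 : pospow n.+1 0 = 0 by rewrite /pospow maxxx expr0n.
  have : pospow n.+1 @ 0^' --> pospow n.+1 0.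
    by apply: cvg_within_filter; exact: pospow_continuous.
  by rewrite E0.
rewrite /pospow maxxx expr0n mulr0.
by apply: DeriveDef; [apply/cvg_ex; exists 0|exact: cvg_lim h].
Unshelve. all: by end_near. Qed.

Lemma line_derive (g : R -> R) i j x (c e dg : R) :
  is_derive (c * x 0 j + e) 1 g dg ->
  is_derive x (delta_mx 0 i) (fun y : 'rV[R]_d => g (c * y 0 j + e))
    (c * (i == j)%:R * dg).
Proof.
move=> gd.
have g2 : is_derive (x 0 j) (i == j)%:R (fun t : R => g (c * t + e))
    (c * (i == j)%:R * dg).
  case: eqP => _; last by rewrite mulr0 mul0r; exact: is_derive0.
  rewrite mulr1 mulrC; apply: (@is_derive1_comp _ g (fun t => c * t + e)) => //.
  have := @is_deriveD R R R (c *: (id : R -> R)) (cst e) (x 0 j) 1 (c *: 1) 0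
    (@is_deriveZ R R R id c (x 0 j) 1 1 (is_derive_id _ _)) (is_derive_cst _ _ _).
  by rewrite addr0 [c *: 1]mulr1.
have E : (fun h : R =>
    h^-1 *: (((fun y : 'rV[R]_d => g (c * y 0 j + e)) \o shift x) (h *: delta_mx 0 i)
     - g (c * x 0 j + e))) =
  (fun h : R => h^-1 *: (((fun t : R => g (c * t + e)) \o shift (x 0 j)) (h *: (i == j)%:R)
     - g (c * x 0 j + e))).
  by apply/funext => h /=; rewrite !mxE eqxx [j == i]eq_sym.
by case: g2 => dg2 vg2; apply: DeriveDef; [rewrite /derivable E|rewrite /derive E].
Qed.

Lemma Cclass_pospow n j (c e : R) :
  Cclass n (fun x : 'rV[R]_d => pospow n.+1 (c * x 0 j + e)).
Proof.
have cl : continuous (fun x : 'rV[R]_d => c * x 0 j + e).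
  apply: continuous_D; last exact: cst_continuous.
  apply: continuous_M; [exact: cst_continuous|exact: coord_continuous].
have cp k : continuous (fun x : 'rV[R]_d => pospow k (c * x 0 j + e)).
  by move=> x; apply: (continuous_comp (cl x)); exact: pospow_continuous.
elim: n => [|n IH]; split => // i.
have dp x := line_derive i (pospow_derive n (c * x 0 j + e)).
split=> [x|]; first by have [] := dp x.
rewrite (_ : partial i _ =
  fun x => (c * (i == j)%:R * n.+2%:R) * pospow n.+1 (c * x 0 j + e)).
  exact: CclassZ.
by apply/funext => x; rewrite -mulrA; have [_ <-] := dp x.
Qed.

End calculus_of_Cclass.

(** * Test functions *)

Section compact_support.
Context {R : realType} {d : nat}.
Implicit Types (f g : 'rV[R]_d -> R) (x v : 'rV[R]_d) (K : set 'rV[R]_d).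

Lemma Cc_intro n f K : Cclass n f -> compact K -> (forall x, ~ K x -> f x = 0) ->
  Cc n f.
Proof.
move=> Cf cK fK; split => //.
have Kc : closed K by apply: (compact_closed (@norm_hausdorff R 'rV[R]_d)).
apply: (subclosed_compact (@closed_closure _ _) cK).
rewrite [X in _ `<=` X]((closure_id K).1 Kc); apply: closure_subset => x /= fx.
by apply: contrapT => nK; move: fx; rewrite fK ?eqxx.
Qed.

Lemma Cc_supp n f : Cc n f ->
  exists2 K, compact K & forall x, ~ K x -> f x = 0.
Proof.
move=> [_ cK]; exists (closure [set x | f x != 0]) => // x nK.
by apply/eqP; apply: contra_notT nK => fx; exact: subset_closure.
Qed.

Lemma partial_supp f K i x : closed K -> (forall y, ~ K y -> f y = 0) ->
  ~ K x -> partial i f x = 0.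
Proof.
move=> cK fK nK; rewrite /partial (@near_eq_derive _ _ _ _ (cst 0)) ?derive_cst//.
have oK : open (~` K) by rewrite openC.
have : nbhs x (~` K) by exact: open_nbhs_nbhs.
by apply: (@filterS _ (nbhs (x : 'rV[R]_d)) _) => y /= /fK.
Qed.

Lemma Cc_partial n f i : Cc n.+1 f -> Cc n (partial i f).
Proof.
move=> Cf; have [K cK fK] := Cc_supp Cf; apply: (@Cc_intro _ _ K) => //.
  exact/Cclass_partial/Cf.1.
move=> x; apply: partial_supp => //.
exact: (compact_closed (@norm_hausdorff R 'rV[R]_d) cK).
Qed.

Lemma CcS n f : Cc n.+1 f -> Cc n f.
Proof. by move=> [Cf cK]; split => //; exact: CclassS. Qed.

Lemma Cc0 n f : Cc n f -> Cc 0 f.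
Proof. by elim: n => // n IH /CcS. Qed.

Lemma CcM n f g : Cc n f -> Cclass n g -> Cc n (fun x => f x * g x).
Proof.
move=> Cf Cg; have [K cK fK] := Cc_supp Cf.
apply: (Cc_intro _ cK); first by apply: CclassM => //; exact: Cf.1.
by move=> x /fK ->; rewrite mul0r.
Qed.

Lemma CcMl n f g : Cclass n g -> Cc n f -> Cc n (fun x => g x * f x).
Proof. by move=> Cg Cf; under eq_fun do rewrite mulrC; exact: CcM. Qed.

Lemma CcD n f g : Cc n f -> Cc n g -> Cc n (fun x => f x + g x).
Proof.
move=> Cf Cg; have [K cK fK] := Cc_supp Cf; have [K' cK' gK] := Cc_supp Cg.
apply: (@Cc_intro _ _ (K `|` K')); first exact: CclassD Cf.1 Cg.1.
  exact: compactU.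
by move=> x /not_orP[/fK -> /gK ->]; rewrite addr0.
Qed.

Lemma Cc_cst0 n : Cc n (fun _ : 'rV[R]_d => 0 : R).
Proof. by apply: (@Cc_intro _ _ set0) => //; [exact: Cclass_cst|exact: compact0]. Qed.

Lemma Cc_sum n m (F : 'I_m -> 'rV[R]_d -> R) : (forall i, Cc n (F i)) ->
  Cc n (fun x => \sum_i F i x).
Proof.
move=> CF; elim: m F CF => [|m IH] F CF.
  by under eq_fun do rewrite big_ord0; exact: Cc_cst0.
by under eq_fun do rewrite big_ord_recl; apply: CcD => //; exact: IH.
Qed.

Lemma Cc_bounded n f : Cc n f -> exists2 M, 0 < M & forall x, `|f x| <= M.
Proof.
move=> Cf; have [K cK fK] := Cc_supp Cf.
have cf := Cclass_continuous Cf.1.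
have /compact_bounded[M [_ Mf]] : compact (f @` K).
  exact: (continuous_compact (continuous_subspaceT cf) cK).
exists (`|M| + 1); first by rewrite ltr_pwDr.
move=> x; have [Kx|nKx] := pselect (K x).
  by apply: Mf; [rewrite ltr_pwDr// ler_norm|exists x].
by rewrite fK// normr0 addr_ge0.
Qed.

Lemma partial_shift f i x v :
  partial i (fun y : 'rV[R]_d => f (y + v)) x = partial i f (x + v).
Proof.
have E : (fun h : R =>
    h^-1 *: (((fun y : 'rV[R]_d => f (y + v)) \o shift x) (h *: delta_mx 0 i)
      - f (x + v))) =
  (fun h => h^-1 *: ((f \o shift (x + v)) (h *: delta_mx 0 i) - f (x + v))).
  by apply/funext => h /=; rewrite addrA.
by rewrite /partial /derive E.
Qed.

Lemma derivable_shift f i x v : derivable f (x + v) (delta_mx 0 i) ->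
  derivable (fun y : 'rV[R]_d => f (y + v)) x (delta_mx 0 i).
Proof.
rewrite /derivable => h; rewrite (_ : (fun _ => _) =
  (fun h => h^-1 *: ((f \o shift (x + v)) (h *: delta_mx 0 i) - f (x + v))))//.
by apply/funext => e /=; rewrite addrA.
Qed.

Lemma continuous_comp_shift f v : continuous f -> continuous (fun y : 'rV[R]_d => f (y
  + v)).
Proof. move=> cf x.
exact: (@continuous_comp _ _ _ (fun y : 'rV[R]_d => y + v) f x
  (@shift_continuous R d v x) (cf (x + v))). Qed.

Lemma Cclass_shift n f v : Cclass n f -> Cclass n (fun y : 'rV[R]_d => f (y + v)).
Proof.
elim: n f => [|n IH] f Cf; split => //.
- exact: (continuous_comp_shift (Cclass_continuous Cf)).
- exact: (continuous_comp_shift (Cclass_continuous Cf)).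
move=> i; split=> [x|]; first exact/derivable_shift/(@Cclass_derivable _ _ n).
rewrite (_ : partial i _ = fun x => partial i f (x + v)).
  exact/IH/Cclass_partial.
by apply/funext => x; exact: partial_shift.
Qed.

Lemma Cc_shift n f v : Cc n f -> Cc n (fun y : 'rV[R]_d => f (y + v)).
Proof.
move=> Cf; have [K cK fK] := Cc_supp Cf; have [M M0 KM] := compact_sub_cube cK.
apply: (@Cc_intro _ _ (closed_box (const_mx (- M) - v) (const_mx M - v))).
- exact: Cclass_shift Cf.1.
- exact: closed_box_compact.
move=> x nx; apply: fK => /KM; apply: contra_not nx => h i.
by have := h i; rewrite !mxE lerBrDr lerBlDr.
Qed.

(** A power 3 makes the product twice continuously differentiable. *)
Definition box_bump (a b x : 'rV[R]_d) : R :=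
  \prod_i (pospow 3 (x 0 i - a 0 i) * pospow 3 (b 0 i - x 0 i)).

Lemma pospow_ge0 n (t : R) : 0 <= pospow n t.
Proof. by apply: exprn_ge0; rewrite le_max lexx orbT. Qed.

Lemma pospow_gt0 n (t : R) : (0 < pospow n.+1 t) = (0 < t).
Proof.
rewrite /pospow; have [t0|t0] := leP t 0; last exact: exprn_gt0.
by rewrite expr0n ltxx.
Qed.

Lemma bump_ge0 a b x : 0 <= box_bump a b x.
Proof. by apply: prodr_ge0 => i _; rewrite mulr_ge0 ?pospow_ge0. Qed.

Lemma bump_gt0 a b x : open_box a b x -> 0 < box_bump a b x.
Proof.
move=> xab; apply: prodr_gt0 => i _; have /andP[ax xb] := xab i.
by rewrite mulr_gt0 ?pospow_gt0 ?subr_gt0.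
Qed.

Lemma bump_eq0 a b x : ~ open_box a b x -> box_bump a b x = 0.
Proof.
move=> nx; apply/eqP/negPn/negP => b0; apply: nx => i.
move: b0; rewrite /box_bump; move/prodf_neq0 => /(_ i isT).
rewrite mulf_eq0 negb_or.
have h (t : R) : (pospow 3 t != 0) = (0 < t) :> bool.
  by rewrite -(pospow_gt0 2 t) [RHS]lt0r pospow_ge0 andbT.
by rewrite !h !subr_gt0.
Qed.

Lemma Cclass_bump a b : Cclass 2 (box_bump a b).
Proof.
apply: Cclass_prod => i; apply: CclassM.
  have := @Cclass_pospow R d 2 i 1 (- a 0 i).
  by congr Cclass; apply/funext => x; rewrite mul1r.
have := @Cclass_pospow R d 2 i (-1) (b 0 i).
by congr Cclass; apply/funext => x; rewrite mulN1r addrC.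
Qed.

Lemma Cc_bump a b : Cc 2 (box_bump a b).
Proof.
apply: (@Cc_intro 2 _ (closed_box a b) (Cclass_bump a b)).
  exact: closed_box_compact.
move=> x nx.
by apply: bump_eq0; apply: contra_not nx => h i; have /andP[/ltW -> /ltW ->] := h i.
Qed.

(** A rational function of the bump, hence of class C^2, which increases with n
to the indicator function of the open box. *)
Definition box_approx (a b : 'rV[R]_d) (n : nat) (x : 'rV[R]_d) : R :=
  box_bump a b x * (n%:R * (1 + n%:R * box_bump a b x)^-1).

Lemma box_approx_den a b n x : 0 < 1 + n%:R * box_bump a b x.
Proof. by rewrite ltr_pwDl// mulr_ge0 ?bump_ge0. Qed.

Lemma Cc_box_approx a b n : Cc 2 (box_approx a b n).
Proof.
apply: CcM; first exact: Cc_bump.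
apply: CclassZ; apply: CclassV => [x|]; first exact/lt0r_neq0/box_approx_den.
by apply: CclassD; [exact: Cclass_cst|apply/CclassZ/Cclass_bump].
Qed.

Lemma box_approx_le1 a b n x : `|box_approx a b n x| <= 1.
Proof.
have h := box_approx_den a b n x.
rewrite /box_approx mulrA (mulrC (box_bump a b x)) ger0_norm; last first.
  by rewrite divr_ge0 ?(ltW h)// mulr_ge0 ?bump_ge0.
by rewrite ler_pdivrMr// mul1r lerDr.
Qed.

Lemma box_approx_eq0 a b n x : ~ open_box a b x -> box_approx a b n x = 0.
Proof. by move=> nx; rewrite /box_approx bump_eq0 ?mul0r. Qed.

Lemma box_approx_cvg a b x :
  box_approx a b n x @[n --> \oo] --> (\1_(open_box a b) x : R).
Proof.
have [xab|nx] := pselect (open_box a b x); last first.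
  rewrite indicE memNset//; under eq_fun do rewrite box_approx_eq0//.
  exact: cvg_cst.
rewrite indicE mem_set//; have b0 := bump_gt0 xab; set w := box_bump a b x in b0.
have E n : box_approx a b n x = 1 - (1 + n%:R * w)^-1.
  have h := box_approx_den a b n x.
  by rewrite /box_approx -/w; field; rewrite lt0r_neq0.
under eq_fun do rewrite E.
have c : (1 + n%:R * w)^-1 @[n --> \oo] --> (0 : R).
  apply/gtr0_cvgV0; first by near=> n; exact: (box_approx_den a b n x).
  apply/cvgryPge => A; near=> n.
  have An : A / w <= n%:R by near: n; exact: nbhs_infty_ger.
  by move: An; rewrite ler_pdivrMr// => /le_trans; apply; rewrite lerDr.
have := @cvgB R R _ _ _ (fun=> 1) _ (1 : R) 0 (@cvg_cst _ _ _ _ _) c.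
by rewrite subr0; exact.
Unshelve. all: by end_near. Qed.

End compact_support.

(** * Local integrability and the fundamental lemma *)

Section local_integrability.
Context {R : realType} {d : nat} (lam : {measure set 'rV[R]_d -> \bar R}).
Hypothesis hlam : is_lebesgue lam.
Implicit Types (f g u q phi : 'rV[R]_d -> R) (x : 'rV[R]_d) (K : set 'rV[R]_d).

Lemma real_dominated_convergence (F : nat -> 'rV[R]_d -> R) f g :
  (forall n, measurable_fun setT (F n)) ->
  (forall x, F n x @[n --> \oo] --> f x) ->
  (forall n x, `|F n x| <= g x) ->
  lam.-integrable setT (EFin \o g) ->
  \int[lam]_x F n x @[n --> \oo] --> \int[lam]_x f x.
Proof.
move=> mF Ff Fg ig.
have mf : measurable_fun setT f by apply: (measurable_fun_cvg mF) => x _; exact: Ff.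
have Fe x : setT x -> (EFin \o F n) x @[n --> \oo] --> (EFin \o f) x.
  by move=> _; apply: cvg_EFin; [exact: nearW|exact: Ff].
have [fint _] := @dominated_convergence _ _ _ lam setT measurableT
  (fun n => EFin \o F n) (EFin \o f) (EFin \o g)
  (fun n => (measurable_EFinP _ _).2 (mF n)) ((measurable_EFinP _ _).2 mf)
  (aeW _ Fe) ig
  (aeW _ (fun x n _ => Fg n x)).
move=> h; apply: fine_cvg; rewrite fineK//.
exact: integrable_fin_num fint.
Qed.

(** A class of multipliers of locally integrable functions that contains both
the continuous coefficients and the essentially bounded potential. *)
Definition loc_ess_bounded q : Prop :=
  measurable_fun setT q /\ forall K, compact K ->
    exists2 M : R, 0 <= M & {ae lam, forall x, K x -> `|q x| <= M}.

Lemma continuous_loc_ess_bounded q : continuous q -> loc_ess_bounded q.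
Proof.
move=> cq; split; first exact: continuous_measurable_rV.
move=> K cK; have : compact (q @` K).
  exact: (continuous_compact (continuous_subspaceT cq) cK).
move=> /compact_bounded[M [_ Mq]]; exists (`|M| + 1); first exact: addr_ge0.
apply: aeW => x Kx; apply: (Mq (`|M| + 1)); last by exists x.
by rewrite ltr_pwDr// ler_norm.
Qed.

Lemma loc_ess_boundedD q u : loc_ess_bounded q -> loc_ess_bounded u ->
  loc_ess_bounded (fun x => q x + u x).
Proof.
move=> [mq bq] [mu bu]; split; first exact: measurable_funD.
move=> K cK; have [M M0 qM] := bq K cK; have [N N0 uN] := bu K cK.
exists (M + N); first exact: addr_ge0.
by apply: filterS2 qM uN => x qx ux Kx; rewrite (le_trans (ler_normD _ _))// lerD ?qx ?ux.
Qed.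

Lemma loc_ess_boundedM q u : loc_ess_bounded q -> loc_ess_bounded u ->
  loc_ess_bounded (fun x => q x * u x).
Proof.
move=> [mq bq] [mu bu]; split; first exact: measurable_funM.
move=> K cK; have [M M0 qM] := bq K cK; have [N N0 uN] := bu K cK.
exists (M * N); first exact: mulr_ge0.
by apply: filterS2 qM uN => x qx ux Kx; rewrite normrM ler_pM ?qx ?ux.
Qed.

Lemma loc_integrableM q u : loc_ess_bounded q -> loc_integrable lam u ->
  loc_integrable lam (fun x => q x * u x).
Proof.
move=> [mq bq] [mu iu]; split; first exact: measurable_funM.
move=> K cK; have mK := compact_measurable_rV cK.
have [M M0 qM] := bq K cK; have iuK := iu K cK.
have iMu : lam.-integrable K (fun x => M%:E * `|(u x)%:E|)%E.
  by apply: integrableZl => //; exact: integrable_abse.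
have mqu : measurable_fun K (fun x => q x * u x).
  by apply: measurable_funTS; exact: measurable_funM.
apply/integrableP; split; first exact/measurable_EFinP.
apply: le_lt_trans (integrable_lty mK iMu).
apply: ae_ge0_le_integral => //.
- by apply/measurableT_comp => //; exact/measurable_EFinP.
- by move=> x _; rewrite mule_ge0.
- exact: measurable_int iMu.
- apply: filterS qM => x h Kx; rewrite /= -EFinM lee_fin normrM.
  by rewrite ler_wpM2r// h.
Qed.

Lemma loc_integrableD u q : loc_integrable lam u -> loc_integrable lam q ->
  loc_integrable lam (fun x => u x + q x).
Proof.
move=> [mu iu] [mq iq]; split; first exact: measurable_funD.
move=> K cK; have mK := compact_measurable_rV cK.
by have := integrableD mK (iu K cK) (iq K cK).
Qed.

Lemma loc_integrable_cont q u : continuous q -> loc_integrable lam u ->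
  loc_integrable lam (fun x => q x * u x).
Proof. by move=> /continuous_loc_ess_bounded; exact: loc_integrableM. Qed.

Lemma loc_integrableZ (c : R) u : loc_integrable lam u ->
  loc_integrable lam (fun x => c * u x).
Proof. by apply: loc_integrable_cont; exact: cst_continuous. Qed.

Lemma loc_integrableB u q : loc_integrable lam u -> loc_integrable lam q ->
  loc_integrable lam (fun x => u x - q x).
Proof.
move=> iu iq; have := loc_integrableD iu (loc_integrableZ (-1) iq).
by under eq_fun do rewrite mulN1r.
Qed.

Lemma loc_integrable_cst (c : R) : loc_integrable lam (fun=> c).
Proof.
split => // K cK; apply: measurable_bounded_integrable => //.
- exact: compact_measurable_rV.
- exact: compact_lty.
- exact: bounded_cst.
Qed.

Lemma loc_ess_bounded_integrable q : loc_ess_bounded q -> loc_integrable lam q.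
Proof.
move=> bq; have := loc_integrableM bq (loc_integrable_cst 1).
by under eq_fun do rewrite mulr1.
Qed.

Lemma continuous_loc_integrable q : continuous q -> loc_integrable lam q.
Proof. by move=> /continuous_loc_ess_bounded/loc_ess_bounded_integrable. Qed.

Lemma loc_integrable_sum m (F : 'I_m -> 'rV[R]_d -> R) :
  (forall i, loc_integrable lam (F i)) ->
  loc_integrable lam (fun x => \sum_i F i x).
Proof.
move=> CF; elim: m F CF => [|m IH] F CF.
  by under eq_fun do rewrite big_ord0; exact: loc_integrable_cst.
by under eq_fun do rewrite big_ord_recl; apply: loc_integrableD => //; exact: IH.
Qed.

Lemma integrable_off_compact u K : compact K -> loc_integrable lam u ->
  lam.-integrable setT (EFin \o (u \_ K)).
Proof.
move=> cK [_ iu]; have := (integrable_mkcond _ (compact_measurable_rV cK)).1 (iu K cK).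
by rewrite restrict_EFin.
Qed.

Lemma integrable_loc_supp u K : compact K -> loc_integrable lam u ->
  (forall x, ~ K x -> u x = 0) -> lam.-integrable setT (EFin \o u).
Proof.
move=> cK iu uK; have := integrable_off_compact cK iu.
congr (lam.-integrable _ (EFin \o _)); apply/funext => x.
by rewrite /patch; case: ifPn => // /negP xK; rewrite uK// => /mem_set.
Qed.

Lemma integrable_Cc phi u : Cc 0 phi -> loc_integrable lam u ->
  lam.-integrable setT (EFin \o (fun x => phi x * u x)).
Proof.
move=> Cphi iu; have [K cK phiK] := Cc_supp Cphi.
apply: (integrable_loc_supp cK); last by move=> x /phiK ->; rewrite mul0r.
by apply: loc_integrable_cont => //; exact: Cclass_continuous Cphi.1.
Qed.

Lemma open_box_integrable u a b : loc_integrable lam u ->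
  lam.-integrable (open_box a b) (EFin \o u).
Proof.
move=> iu; apply: (@integrableS _ _ _ _ (closed_box a b)) => //.
- exact: closed_box_measurable.
- exact: open_box_measurable.
- exact: open_box_closed_box.
- by apply: iu.2; exact: closed_box_compact.
Qed.

(** Test with functions that increase to the indicator of the box. *)
Lemma open_box_int0 u a b : loc_integrable lam u ->
  (forall phi, Cc 2 phi -> \int[lam]_x (u x * phi x) = 0) ->
  (\int[lam]_(x in open_box a b) (u x)%:E = 0)%E.
Proof.
move=> iu u0.
have mo := open_box_measurable a b.
have ioff : lam.-integrable setT (EFin \o (Num.norm \o (u \_ (closed_box a b)))).
  apply: integrable_norm => //; apply: integrable_off_compact iu.
  exact: closed_box_compact.
have h : \int[lam]_x (u x * box_approx a b n x) @[n --> \oo] -->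
    \int[lam]_x (u \_ (open_box a b)) x.
  apply: (real_dominated_convergence _ _ _ ioff).
  - move=> n; apply: measurable_funM; first exact: iu.1.
    exact: continuous_measurable_rV (Cclass_continuous (Cc_box_approx a b n).1).
  - move=> x; rewrite patch_indic; apply: cvgM; first exact: cvg_cst.
    exact: box_approx_cvg.
  - move=> n x /=; have [ox|nx] := pselect (closed_box a b x).
      by rewrite normrM /patch mem_set// ler_piMr// box_approx_le1.
    by rewrite box_approx_eq0 ?mulr0 ?normr0// => /open_box_closed_box.
have : (fun n => \int[lam]_x (u x * box_approx a b n x)) = (fun=> 0).
  by apply/funext => n; apply: u0; exact: Cc_box_approx.
move=> E; rewrite E in h.
have {h} h : \int[lam]_x (u \_ (open_box a b)) x = 0.
  exact: (cvg_unique _ h (@cvg_cst _ _ _ _ _)).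
move: h; rewrite -Rintegral_mkcond /Rintegral => h.
rewrite -[LHS]fineK ?h//; apply: integrable_fin_num => //.
exact: open_box_integrable.
Qed.

(** The open boxes are stable under intersection and generate the Borel sets, so
the vanishing of the integrals over boxes extends to all Borel subsets of a
cube. *)
Lemma fundamental_lemma u : loc_integrable lam u ->
  (forall phi, Cc 2 phi -> \int[lam]_x (u x * phi x) = 0) ->
  {ae lam, forall x, u x = 0}.
Proof.
move=> iu u0.
pose cube_ n : set 'rV[R]_d := open_box (const_mx (- n%:R)) (const_mx n%:R).
have mcube n : measurable (cube_ n) by exact: open_box_measurable.
have aen n : {ae lam, forall x, cube_ n x -> u x = 0}.
  have iuc : lam.-integrable (cube_ n) (EFin \o u) by exact: open_box_integrable.
  have iE E : measurable E -> lam.-integrable (cube_ n `&` E) (EFin \o u).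
    by move=> mE; apply: integrableS iuc => //; exact: measurableI.
  have intE0 E : measurable E -> (\int[lam]_(x in cube_ n `&` E) (u x)%:E = 0)%E.
    pose G : set (set 'rV[R]_d) := [set open_box ab.1 ab.2 | ab in setT].
    have gen : measurable = <<s G >>.
      apply: boxes_generate => a b //; first exact: open_box_closed_box.
      exact: open_box_measurable.
    suff h S : <<s G >> S -> (\int[lam]_(x in cube_ n `&` S) (u x)%:E = 0)%E.
      by move=> mE; apply: h; rewrite -gen.
    apply: (dynkin_induction gen (P := fun S =>
      (\int[lam]_(x in cube_ n `&` S) (u x)%:E = 0)%E)) => {S}.
    - move=> _ _ [[a b] _ <-] [[a' b'] _ <-]; rewrite open_boxI.
      by exists (\row_i Num.max (a 0 i) (a' 0 i), \row_i Num.min (b 0 i) (b' 0 i)).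
    - by rewrite setIT; exact: open_box_int0.
    - by move=> _ [[a b] _ <-] /=; rewrite open_boxI; exact: open_box_int0.
    - move=> S mS S0.
      have : (\int[lam]_(x in (cube_ n `&` S) `|` (cube_ n `&` ~` S)) (u x)%:E = 0)%E.
        by rewrite -setIUr setUv setIT; exact: open_box_int0.
      rewrite integral_setU_EFin ?S0 ?add0e//; try exact: measurableI.
      + by apply: measurableI => //; exact: measurableC.
      + apply: measurable_funTS; exact: iu.1.
      + apply/disj_setPS => x [[_ Sx] [_ nSx]]; exact: nSx.
    - move=> F mF tF F0; rewrite setI_bigcupr integral_bigcup.
      + by apply: eseries0 => k _ _; exact: F0.
      + by apply: trivIset_setIl.
      + by move=> k; exact: measurableI.
      + by rewrite -setI_bigcupr; apply: iE; exact: bigcup_measurable.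
  have intE E : E `<=` cube_ n -> measurable E ->
      (\int[lam]_(x in E) (EFin \o u) x = \int[lam]_(x in E) cst 0 x)%E.
    by move=> En mE; rewrite integral0 -(setIidr En); exact: intE0.
  have := integral_ae_eq (mcube n) iuc (measurable_cst _) intE.
  by apply: filterS => x h /h [].
have : {ae lam, forall x n, cube_ n x -> u x = 0}.
  exact/ae_foralln.
apply: filterS => x h.
have xn := archi_boundP (normr_ge0 (x : 'rV[R]_d)).
apply: (h (Num.bound `|x : 'rV[R]_d|)) => i; rewrite !mxE.
by have := le_lt_trans (le_coord_norm x i) xn; rewrite ltr_norml.
Qed.

End local_integrability.

(** * Mollification *)

Section mollification.
Context {R : realType} {d : nat} (lam : {measure set 'rV[R]_d -> \bar R}).
Hypothesis hlam : is_lebesgue lam.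
Implicit Types (f g u phi : 'rV[R]_d -> R) (x y z v : 'rV[R]_d).

(** The convolution of u with the reflection of phi. *)
Definition mollify phi u x : R := \int[lam]_y (phi (y - x) * u y).

Lemma Cclass_line_derive n phi i z (h : R) : Cclass n.+1 phi ->
  is_derive h 1 (fun t : R => phi (t *: delta_mx 0 i + z))
    (partial i phi (h *: delta_mx 0 i + z)).
Proof.
move=> Cphi; have dphi := @Cclass_derivable _ _ n phi i (h *: delta_mx 0 i + z) Cphi.
have E : (fun t : R => t^-1 *: (((fun s : R => phi (s *: delta_mx 0 i + z)) \o shift h)
    (t *: (1 : R)) - phi (h *: delta_mx 0 i + z))) =
  (fun t : R => t^-1 *: ((phi \o shift (h *: delta_mx 0 i + z)) (t *: delta_mx 0 i)
    - phi (h *: delta_mx 0 i + z))).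
  by apply/funext => t /=; rewrite [t *: (1 : R)]mulr1 scalerDl addrA.
by apply: DeriveDef; [rewrite /derivable E|rewrite /partial /derive E].
Qed.

Lemma loc_integrable_mollify_int phi u x : Cc 0 phi -> loc_integrable lam u ->
  lam.-integrable setT (EFin \o (fun y => phi (y - x) * u y)).
Proof. by move=> Cphi iu; apply: integrable_Cc => //; apply: Cc_shift. Qed.

(** The supports of the translates of a test function by bounded vectors lie in
one compact set. *)
Lemma shift_dominated phi u x : Cc 0 phi -> loc_integrable lam u ->
  exists2 G : 'rV[R]_d -> R, lam.-integrable setT (EFin \o G) &
    forall v y, (forall i, `|v 0 i| <= 1) -> `|phi (y - (v + x)) * u y| <= G y.
Proof.
move=> Cphi iu; have [K cK phiK] := Cc_supp Cphi.
have [N N0 KN] := compact_sub_cube cK; have [M M0 phiM] := Cc_bounded Cphi.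
pose K' := closed_box (const_mx (- (N + 1)) + x) (const_mx (N + 1) + x).
exists (fun y => M * `|(u \_ K') y|).
  have : lam.-integrable setT (EFin \o (Num.norm \o (u \_ K'))).
    apply: integrable_norm => //; apply: integrable_off_compact => //.
    exact: closed_box_compact.
  by move=> /(integrableZl measurableT M).
move=> v y v1; have [Ky|nKy] := pselect (K' y).
  by rewrite /patch mem_set// normrM ler_wpM2r.
rewrite phiK ?mul0r ?normr0 ?mulr_ge0 ?(ltW M0)// => /KN/cubeE h.
apply: nKy => i; have := h i; have := v1 i; rewrite !mxE !ler_norml.
by move=> *; lra.
Qed.

(** Differentiation under the integral sign along a coordinate line; the sign
comes from the reflection of phi. *)
Lemma mollify_derive n phi u i x : Cc n.+1 phi -> loc_integrable lam u ->
  is_derive x (delta_mx 0 i) (mollify phi u) (- mollify (partial i phi) u x).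
Proof.
move=> Cphi iu; have Cphi0 := Cc0 Cphi.
have [G iG phiG] := shift_dominated x (Cc0 (Cc_partial i Cphi)) iu.
pose F (h : R) y := phi (y - (h *: delta_mx 0 i + x)) * u y.
have dF (h : R) y : is_derive h 1 (F ^~ y)
    (- partial i phi (y - (h *: delta_mx 0 i + x)) * u y).
  have E : (F ^~ y) = (fun h : R => u y *: phi ((- h) *: delta_mx 0 i + (y - x))).
    apply/funext => t; rewrite /F mulrC scaleNr; congr (_ * phi _).
    by rewrite opprD addrCA addrA.
  have -> : y - (h *: delta_mx 0 i + x) = (- h) *: delta_mx 0 i + (y - x).
    by rewrite scaleNr opprD addrCA addrA.
  rewrite E mulrC; apply: is_deriveZ.
  rewrite -mulrN1.
  exact: (@is_derive1_comp _ (fun t : R => phi (t *: delta_mx 0 i + (y - x))) -%R h _ _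
    (Cclass_line_derive i (y - x) (- h) Cphi.1)).
have iF (h : R) : lam.-integrable setT (EFin \o F h).
  exact: loc_integrable_mollify_int.
have d1F (h : R) y : partial1of2 F h y = - partial i phi (y - (h *: delta_mx 0 i + x))
  * u y.
  by rewrite partial1of2E; have [_ ->] := dF h y.
have h1 (h : R) : h \in `](-1), 1[ -> forall j, `|(h *: delta_mx 0 i : 'rV[R]_d) 0 j| <= 1.
  rewrite in_itv /= -ltr_norml => h1 j; rewrite !mxE eqxx /= normrM.
  by case: (j == i); rewrite ?normr1 ?normr0 ?mulr1 ?mulr0 ?(ltW h1).
have I0 : `](-1 : R), 1[%classic (0 : R) by rewrite /= in_itv /= ltrN10 ltr01.
have G0 y : 0 <= G y by apply: le_trans (normr_ge0 _) (phiG 0 y _) => j; rewrite mxE normr0.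
have GF (h : R) y : `](-1 : R), 1[%classic h -> setT y -> `|partial1of2 F h y| <= G y.
  by move=> hI _; rewrite d1F mulNr normrN; apply: phiG; exact: h1.
have := @cvg_differentiation_under_integral R _ _ lam F setT measurableT
  0 (-1) 1 I0 (fun h _ => iF h) (fun h y _ _ => (@ex_derive _ _ _ _ _ _ _ (dF h y)))
  G G0 iG GF.
rewrite (_ : \int[lam]_y partial1of2 F 0 y = - mollify (partial i phi) u x); last first.
  rewrite /mollify -mulN1r -RintegralZl//; last first.
    exact: loc_integrable_mollify_int (Cc0 (Cc_partial i Cphi)) iu.
  by apply: eq_Rintegral => y _; rewrite d1F scale0r add0r mulN1r mulNr.
rewrite (_ : (fun h : R => _) = (fun h : R =>
    h^-1 *: ((mollify phi u \o shift x) (h *: delta_mx 0 i) - mollify phi u x))); last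
      first.
  apply/funext => h; rewrite addr0 /= /mollify; congr (_ *: (_ - _)).
  by apply: eq_Rintegral => y _; rewrite /F scale0r add0r.
by move=> h; apply: DeriveDef; [apply/cvg_ex; eexists; exact: h|exact: cvg_lim h].
Qed.

Lemma seq_continuous f : (forall (y : nat -> 'rV[R]_d) x,
    (forall n i, `|y n 0 i - x 0 i| <= n.+1%:R^-1) ->
    f (y n) @[n --> \oo] --> f x) -> continuous f.
Proof.
move=> h x.
apply/(@cvgrPdist_lt _ _ _ (nbhs (x : 'rV[R]_d)) _ f (f x)) => e e0; apply: contrapT => nx.
have /choice[y yP] : forall n : nat, exists y : 'rV[R]_d,
    (forall i, `|y 0 i - x 0 i| <= n.+1%:R^-1) /\ e <= `|f x - f y|.
  move=> n; apply: contrapT => ny; apply: nx.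
  apply/nbhs_ballP; exists n.+1%:R^-1; first by rewrite /= invr_gt0.
  move=> y [_ xy]; rewrite ltNge; apply/negP => le; apply: ny; exists y; split => // i.
  by have := xy 0 i; rewrite /ball /= distrC => /ltW.
have /cvgrPdist_lt /(_ e e0) [N _ /(_ N (leqnn _))] := h y x (fun n => (yP n).1).
by rewrite /= ltNge (yP N).2.
Qed.

Lemma continuous_seq f (y : nat -> 'rV[R]_d) x : continuous f ->
  (forall n i, `|y n 0 i - x 0 i| <= n.+1%:R^-1) -> f (y n) @[n --> \oo] --> f x.
Proof.
move=> cf yx; apply/cvgrPdist_lt => e e0.
have /(@cvgrPdist_lt _ _ _ (nbhs (x : 'rV[R]_d)) _ f (f x))/(_ e e0) := cf x.
move=> /nbhs_ballP[r r0 fr]; near=> n; apply: fr; apply: ball_rV => // i.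
rewrite distrC (le_lt_trans (yx n i))//.
by near: n; exact: near_infty_natSinv_lt (PosNum r0).
Unshelve. all: by end_near. Qed.

Lemma mollify_continuous phi u : Cc 0 phi -> loc_integrable lam u ->
  continuous (mollify phi u).
Proof.
move=> Cphi iu; apply: seq_continuous => y x yx.
have [G iG phiG] := shift_dominated x Cphi iu.
apply: (real_dominated_convergence _ _ _ iG).
- move=> n; apply: measurable_funM; last exact: iu.1.
  have c : continuous (fun z : 'rV[R]_d => phi (z - y n)).
    exact: (@continuous_comp_shift R d phi (- y n) (Cclass_continuous Cphi.1)).
  exact: (continuous_measurable_rV c).
- move=> z; apply: cvgM; last exact: cvg_cst.
  apply: (@continuous_seq phi (fun n => z - y n)); first exact: Cphi.1.1.
  move=> n i; have := yx n i; rewrite !mxE distrC.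
  by rewrite (_ : x 0 i - y n 0 i = z 0 i - y n 0 i - (z 0 i - x 0 i))//; ring.
- move=> n z; have := phiG (y n - x) z; rewrite subrK; apply => i.
  by rewrite !mxE (le_trans (yx n i))// invf_le1 ?ltr0n ?ler1n.
Qed.

Lemma Cclass_mollify n phi u : Cc n phi -> loc_integrable lam u ->
  Cclass n (mollify phi u).
Proof.
move=> + iu; elim: n phi => [|n IH] phi Cphi; split => //.
- exact: mollify_continuous.
- by apply: mollify_continuous => //; exact: Cc0 Cphi.
move=> i; split=> [x|]; first by have [] := mollify_derive i x Cphi iu.
rewrite (_ : partial i _ = fun x => -1 * mollify (partial i phi) u x).
  by apply/CclassZ/IH; exact: Cc_partial.
by apply/funext => x; rewrite mulN1r; have [_ <-] := mollify_derive i x Cphi iu.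
Qed.

Lemma mollify_partial n phi u i x : Cc n.+1 phi -> loc_integrable lam u ->
  partial i (mollify phi u) x = - mollify (partial i phi) u x.
Proof. by move=> Cphi iu; have [_ <-] := mollify_derive i x Cphi iu. Qed.

Lemma Rintegral_shift phi v : Cc 0 phi ->
  \int[lam]_y phi (y + v) = \int[lam]_y phi y.
Proof.
move=> Cphi; rewrite /Rintegral.
have := @integral_pushforward _ _ _ _ R (fun y : 'rV[R]_d => y + v)
   (shift_measurable v) lam setT (EFin \o phi).
rewrite preimage_setT => <- //.
- congr fine; apply: eq_measure_integral; [exact: shift_measurable|move=> ? A mA _].
  exact: (lebesgue_shift hlam v mA).
- apply/measurable_EFinP.
  exact: (continuous_measurable_rV (Cclass_continuous Cphi.1)).
have := integrable_Cc (Cc_shift v Cphi) (loc_integrable_cst hlam 1).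
by under eq_fun do rewrite mulr1.
Qed.

(** Differentiate the integral of the translates of phi, which is constant. *)
Lemma Rintegral_partial phi i : Cc 1 phi -> \int[lam]_y partial i phi y = 0.
Proof.
move=> Cphi; have i1 := loc_integrable_cst hlam 1.
have := mollify_partial i 0 Cphi i1.
rewrite (_ : mollify phi _ = cst (\int[lam]_y phi y)); last first.
  apply/funext => x; rewrite /mollify /=.
  by under eq_Rintegral do rewrite mulr1; rewrite Rintegral_shift//; exact: Cc0 Cphi.
rewrite [LHS]derive_cst /mollify => /esym/eqP; rewrite oppr_eq0 => /eqP <-.
by apply: eq_Rintegral => y _; rewrite mulr1 subr0.
Qed.

End mollification.

(** * Weak derivatives and integrals that vanish *)

Section dot_product.
Context {R : realType} {d : nat}.
Implicit Types (u v w : 'rV[R]_d) (D : 'M[R]_d) (c : R).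

Lemma dotvC u v : dotv u v = dotv v u.
Proof. by apply: eq_bigr => i _; rewrite mulrC. Qed.

Lemma dotvDl u v w : dotv (u + v) w = dotv u w + dotv v w.
Proof. by rewrite -big_split; apply: eq_bigr => i _; rewrite !mxE mulrDl. Qed.

Lemma dotvZl c u v : dotv (c *: u) v = c * dotv u v.
Proof. by rewrite [RHS]big_distrr; apply: eq_bigr => i _; rewrite !mxE /= mulrA. Qed.

Lemma dotvNl u v : dotv (- u) v = - dotv u v.
Proof. by rewrite -scaleN1r dotvZl mulN1r. Qed.

Lemma dotv0l v : dotv 0 v = 0.
Proof. by apply: big1 => i _; rewrite mxE mul0r. Qed.

Lemma dotvDr u v w : dotv u (v + w) = dotv u v + dotv u w.
Proof. by rewrite dotvC dotvDl !(dotvC u). Qed.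

Lemma dotvZr c u v : dotv u (c *: v) = c * dotv u v.
Proof. by rewrite dotvC dotvZl (dotvC u). Qed.

Lemma dotv_sym D u v : D^T = D -> dotv (u *m D) v = dotv u (v *m D).
Proof.
have dotvE w w' : dotv w w' = (w *m w'^T) 0 0.
  by rewrite mxE; apply: eq_bigr => i _; rewrite mxE.
by move=> sD; rewrite !dotvE trmx_mul sD mulmxA.
Qed.

End dot_product.

Section gradient_rules.
Context {R : realType} {d : nat}.
Implicit Types (f g : 'rV[R]_d -> R) (F : 'rV[R]_d -> 'rV[R]_d) (x : 'rV[R]_d).

Lemma gradM n m f g x : Cclass n.+1 f -> Cclass m.+1 g ->
  grad (fun y => f y * g y) x = g x *: grad f x + f x *: grad g x.
Proof.
move=> Cf Cg; apply/rowP => i; rewrite !mxE partialM.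
- by rewrite (mulrC (partial i f x)).
- exact: (@Cclass_derivable _ _ n).
- exact: (@Cclass_derivable _ _ m).
Qed.

Lemma divZ n m f F x : Cclass n.+1 f -> (forall i, Cclass m.+1 (fun y => F y 0 i)) ->
  div (fun y => f y *: F y) x = f x * div F x + dotv (grad f x) (F x).
Proof.
move=> Cf CF; rewrite /div big_distrr -big_split; apply: eq_bigr => i _ /=.
rewrite mxE (_ : (fun y => _) = (fun y => f y * F y 0 i)); last first.
  by apply/funext => y; rewrite mxE.
rewrite partialM 1?addrC//.
- exact: (@Cclass_derivable _ _ n).
- exact: (@Cclass_derivable _ _ m _ i x (CF i)).
Qed.

Lemma Cclass_mulmx n F (D : 'M[R]_d) i :
  (forall j, Cclass n (fun y => F y 0 j)) -> Cclass n (fun y => (F y *m D) 0 i).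
Proof.
move=> CF; under eq_fun do rewrite mxE; apply: Cclass_sum => j.
under eq_fun do rewrite mulrC; exact: CclassZ.
Qed.

Lemma Cclass_grad n f i : Cclass n.+1 f -> Cclass n (fun y => grad f y 0 i).
Proof. by move=> /(Cclass_partial i); congr Cclass; apply/funext => y; rewrite mxE. Qed.

Lemma Cclass_dotv n F F' : (forall j, Cclass n (fun y => F y 0 j)) ->
  (forall j, Cclass n (fun y => F' y 0 j)) -> Cclass n (fun y => dotv (F y) (F' y)).
Proof. by move=> CF CF'; apply: Cclass_sum => i; exact: CclassM. Qed.

Lemma Cclass_div n F : (forall j, Cclass n.+1 (fun y => F y 0 j)) -> Cclass n (div F).
Proof. by move=> CF; apply: Cclass_sum => i; exact: Cclass_partial. Qed.

Lemma Cc_partial_grad n f i : Cc n.+1 f -> Cc n (fun y => grad f y 0 i).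
Proof. by move=> /(Cc_partial i); congr Cc; apply/funext => y; rewrite mxE. Qed.

Lemma Cc_mulmx n F (D : 'M[R]_d) i :
  (forall j, Cc n (fun y => F y 0 j)) -> Cc n (fun y => (F y *m D) 0 i).
Proof.
move=> CF; under eq_fun do rewrite mxE; apply: Cc_sum => j.
by apply: CcM => //; exact: Cclass_cst.
Qed.

Lemma Cc_div n F : (forall j, Cc n.+1 (fun y => F y 0 j)) -> Cc n (div F).
Proof. by move=> CF; apply: Cc_sum => i; exact: Cc_partial. Qed.

Lemma Cc_dotv n F F' : (forall j, Cclass n (fun y => F y 0 j)) ->
  (forall j, Cc n (fun y => F' y 0 j)) -> Cc n (fun y => dotv (F y) (F' y)).
Proof. by move=> CF CF'; apply: Cc_sum => i; exact: CcMl. Qed.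

End gradient_rules.

Section null_integrals.
Context {R : realType} {d : nat} (lam : {measure set 'rV[R]_d -> \bar R}).
Implicit Types (u v : 'rV[R]_d -> R).

(** Each integration by parts is recorded as a function of this kind; the
identities between integrals are then obtained by adding such functions. *)
Definition null_int u := lam.-integrable setT (EFin \o u) /\ \int[lam]_x u x = 0.

Lemma null_intD u v : null_int u -> null_int v -> null_int (fun x => u x + v x).
Proof.
move=> [iu u0] [iv v0]; split; last by rewrite RintegralD// u0 v0 addr0.
by have := integrableD measurableT iu iv.
Qed.

Lemma null_intZ c u : null_int u -> null_int (fun x => c * u x).
Proof.
move=> [iu u0]; split; last by rewrite RintegralZl// u0 mulr0.
by have := integrableZl measurableT c iu.
Qed.

Lemma null_int0 : null_int (fun=> 0).
Proof. by split; [exact: integrable0|rewrite /Rintegral integral0]. Qed.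

Lemma null_int_sum m (F : 'I_m -> 'rV[R]_d -> R) : (forall i, null_int (F i)) ->
  null_int (fun x => \sum_i F i x).
Proof.
move=> CF; elim: m F CF => [|m IH] F CF.
  by under eq_fun do rewrite big_ord0; exact: null_int0.
by under eq_fun do rewrite big_ord_recl; apply: null_intD => //; exact: IH.
Qed.

Lemma integrable_Rsum m (F : 'I_m -> 'rV[R]_d -> R) :
  (forall i, lam.-integrable setT (EFin \o F i)) ->
  lam.-integrable setT (EFin \o (fun x => \sum_i F i x)).
Proof.
move=> iF; have := @integrable_sum _ _ _ lam setT measurableT _ (index_enum 'I_m)
  xpredT _ (fun i _ => iF i).
by congr (lam.-integrable _ _); apply/funext => x /=; rewrite sumEFin.
Qed.

Lemma Rintegral_sum m (F : 'I_m -> 'rV[R]_d -> R) :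
  (forall i, lam.-integrable setT (EFin \o F i)) ->
  \int[lam]_x (\sum_i F i x) = \sum_i \int[lam]_x F i x.
Proof.
elim: m F => [|m IH] F iF.
  under eq_Rintegral do rewrite big_ord0.
  by rewrite big_ord0 /Rintegral integral0.
under eq_Rintegral do rewrite big_ord_recl.
rewrite RintegralD//; last exact: integrable_Rsum.
by rewrite big_ord_recl IH.
Qed.

Lemma Rintegral_ae_eq u v : measurable_fun setT u -> measurable_fun setT v ->
  {ae lam, forall x, u x = v x} -> \int[lam]_x u x = \int[lam]_x v x.
Proof.
move=> mu mv uv; congr fine; apply: ae_eq_integral => //.
- exact/measurable_EFinP.
- exact/measurable_EFinP.
- by apply: filterS uv => x + _ => /= ->.
Qed.

Lemma null_int_eq u v w : measurable_fun setT u ->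
  lam.-integrable setT (EFin \o v) -> null_int w ->
  {ae lam, forall x, u x = v x + w x} -> \int[lam]_x u x = \int[lam]_x v x.
Proof.
move=> mu iv [iw w0] uvw.
rewrite (Rintegral_ae_eq mu _ uvw) ?RintegralD// ?w0 ?addr0//.
apply: measurable_funD; apply/measurable_EFinP.
  exact: measurable_int iv.
exact: measurable_int iw.
Qed.

End null_integrals.

Section weak_derivatives.
Context {R : realType} {d : nat} (lam : {measure set 'rV[R]_d -> \bar R}).
Hypothesis hlam : is_lebesgue lam.
Implicit Types (f g h phi p : 'rV[R]_d -> R) (F G : 'rV[R]_d -> 'rV[R]_d).

Lemma ae_eq_of_test f g : loc_integrable lam f -> loc_integrable lam g ->
  (forall phi, Cc 2 phi -> \int[lam]_x (f x * phi x) = \int[lam]_x (g x * phi x)) ->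
  {ae lam, forall x, f x = g x}.
Proof.
move=> lf lg fg.
have : {ae lam, forall x, f x - g x = 0}.
  apply: fundamental_lemma => //; first exact: loc_integrableB.
  move=> phi Cphi; under eq_Rintegral do rewrite mulrBl.
  have i u : loc_integrable lam u -> lam.-integrable setT (EFin \o (fun x => u x * phi x)).
    by move=> iu; under eq_fun do rewrite mulrC; apply: integrable_Cc => //; exact: Cc0
      Cphi.
  by rewrite RintegralB ?i// fg// subrr.
by apply: filterS => x /eqP; rewrite subr_eq0 => /eqP.
Qed.

Lemma weak_partial_uniq i f g h : is_weak_partial lam i f g ->
  is_weak_partial lam i f h -> {ae lam, forall x, g x = h x}.
Proof.
move=> [_ lg fg] [_ lh fh]; apply: ae_eq_of_test => // phi /CcS Cphi.
by apply: oppr_inj; rewrite -fg// fh.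
Qed.

Lemma weak_div_uniq F g h : is_weak_div lam F g -> is_weak_div lam F h ->
  {ae lam, forall x, g x = h x}.
Proof.
move=> [_ lg fg] [_ lh fh]; apply: ae_eq_of_test => // phi /CcS Cphi.
by apply: oppr_inj; rewrite -fg// fh.
Qed.

Lemma weak_partialP i f : (exists g, is_weak_partial lam i f g) ->
  is_weak_partial lam i f (weak_partial lam i f).
Proof. by move=> [g fg]; exact: (xgetPex (cst 0) (ex_intro _ g fg)). Qed.

Lemma wdivP F : (exists h, is_weak_div lam F h) -> is_weak_div lam F (wdiv lam F).
Proof. by move=> [g fg]; exact: (xgetPex (cst 0) (ex_intro _ g fg)). Qed.

Lemma null_int_weak_partial i f g phi : is_weak_partial lam i f g -> Cc 1 phi ->
  null_int lam (fun x => f x * partial i phi x + g x * phi x).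
Proof.
move=> [lf lg fg] Cphi.
have i1 : lam.-integrable setT (EFin \o (fun x => f x * partial i phi x)).
  under eq_fun do rewrite mulrC; apply: integrable_Cc => //.
  exact: Cc_partial.
have i2 : lam.-integrable setT (EFin \o (fun x => g x * phi x)).
  under eq_fun do rewrite mulrC; apply: integrable_Cc => //.
  exact: Cc0 Cphi.
split; first by have := integrableD measurableT i1 i2.
by rewrite RintegralD// fg// addNr.
Qed.

Lemma null_int_weak_grad f G F : (forall i, is_weak_partial lam i f (fun x => G x 0 i)) ->
  (forall i, Cc 1 (fun x => F x 0 i)) ->
  null_int lam (fun x => f x * div F x + dotv (G x) (F x)).
Proof.
move=> fG CF; have := null_int_sum (fun i => null_int_weak_partial (fG i) (CF i)).
congr null_int; apply/funext => x.
by rewrite big_split -big_distrr.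
Qed.

Lemma loc_integrable_dotv F G : (forall i, loc_integrable lam (fun x => G x 0 i)) ->
  (forall i, continuous (fun x => F x 0 i)) ->
  loc_integrable lam (fun x => dotv (F x) (G x)).
Proof.
by move=> lG cF; apply: loc_integrable_sum => // i; exact: loc_integrable_cont.
Qed.

Lemma integrable_Cc_dotv F G : (forall i, loc_integrable lam (fun x => G x 0 i)) ->
  (forall i, Cc 0 (fun x => F x 0 i)) ->
  lam.-integrable setT (EFin \o (fun x => dotv (F x) (G x))).
Proof.
by move=> lG cF; apply: integrable_Rsum => i; exact: integrable_Cc.
Qed.

Lemma null_int_weak_div F h phi : is_weak_div lam F h -> Cc 1 phi ->
  null_int lam (fun x => dotv (F x) (grad phi x) + h x * phi x).
Proof.
move=> [lf lg fg] Cphi.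
have i1 : lam.-integrable setT (EFin \o (fun x => dotv (F x) (grad phi x))).
  under eq_fun do rewrite dotvC; apply: integrable_Cc_dotv => // i.
  exact: Cc_partial_grad.
have i2 : lam.-integrable setT (EFin \o (fun x => h x * phi x)).
  under eq_fun do rewrite mulrC; apply: integrable_Cc => //.
  exact: Cc0 Cphi.
split; first by have := integrableD measurableT i1 i2.
by rewrite RintegralD// fg// addNr.
Qed.

Lemma Cclass_weak_partial i f : Cclass 1 f -> is_weak_partial lam i f (partial i f).
Proof.
move=> Cf; have cf := Cclass_continuous Cf.
have cdf := Cclass_continuous (Cclass_partial i Cf).
split; [exact: continuous_loc_integrable|exact: continuous_loc_integrable|].
move=> phi Cphi; apply/eqP; rewrite -subr_eq0 opprK; apply/eqP.
rewrite -RintegralD//.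
- rewrite -[RHS](Rintegral_partial hlam i (CcMl Cf Cphi)).
  apply: eq_Rintegral => x _; rewrite partialM 1?addrC//.
    exact: (@Cclass_derivable _ _ 0).
  exact: (@Cclass_derivable _ _ 0 _ i x Cphi.1).
- under eq_fun do rewrite mulrC; apply: integrable_Cc => //.
    exact: Cc_partial.
  exact: continuous_loc_integrable.
- under eq_fun do rewrite mulrC; apply: integrable_Cc => //; first exact: Cc0 Cphi.
  exact: continuous_loc_integrable.
Qed.

Lemma Cclass_weak_div F : (forall i, Cclass 1 (fun x => F x 0 i)) ->
  is_weak_div lam F (div F).
Proof.
move=> CF; have cF i := Cclass_continuous (CF i).
have cdF : continuous (div F) by exact: (Cclass_continuous (Cclass_div CF)).
split; [by move=> i; exact: continuous_loc_integrable|exact: continuous_loc_integrable|].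
move=> phi Cphi; apply/eqP; rewrite -subr_eq0 opprK; apply/eqP.
rewrite -RintegralD//.
- have := null_int_sum (fun i => null_int_weak_partial (Cclass_weak_partial i (CF i)) Cphi).
  move=> [_ <-]; apply: eq_Rintegral => x _.
  rewrite big_split -big_distrl /dotv /=; congr (_ + _).
  by apply: eq_bigr => i _; rewrite mxE.
- under eq_fun do rewrite dotvC; apply: integrable_Cc_dotv => [i|i].
    exact: continuous_loc_integrable.
  exact: Cc_partial_grad.
- under eq_fun do rewrite mulrC; apply: integrable_Cc => //; first exact: Cc0 Cphi.
  exact: continuous_loc_integrable.
Qed.

(** If phi is a test function then so is p phi. *)
Lemma weak_divZ p F h : Cclass 1 p -> is_weak_div lam F h ->
  is_weak_div lam (fun x => p x *: F x) (fun x => p x * h x + dotv (F x) (grad p x)).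
Proof.
move=> Cp Fh; have [lF lh _] := Fh; have cp := Cclass_continuous Cp.
have cgp i := Cclass_continuous (Cclass_grad i Cp).
have lpF i : loc_integrable lam (fun x => (p x *: F x) 0 i).
  by under eq_fun do rewrite mxE; exact: loc_integrable_cont.
have l2 : loc_integrable lam (fun x => p x * h x + dotv (F x) (grad p x)).
  apply: loc_integrableD; first exact: loc_integrable_cont.
  by under eq_fun do rewrite dotvC; exact: loc_integrable_dotv.
split => // phi Cphi; apply/eqP; rewrite -subr_eq0 opprK; apply/eqP.
rewrite -RintegralD//.
- have [_ <-] := null_int_weak_div Fh (CcMl Cp Cphi).
  apply: eq_Rintegral => x _.
  rewrite (gradM x Cp Cphi.1) dotvDr !dotvZr dotvZl; ring.
- under eq_fun do rewrite dotvC; apply: integrable_Cc_dotv => // i.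
  exact: Cc_partial_grad.
- under eq_fun do rewrite mulrC; apply: integrable_Cc => //; exact: Cc0 Cphi.
Qed.

End weak_derivatives.

(** * The stationary current *)

Section averaging.
Context {R : realType} {d : nat} (lam : {measure set 'rV[R]_d -> \bar R}).
Hypothesis hlam : is_lebesgue lam.
Implicit Types (f g u phi p : 'rV[R]_d -> R) (F G j : 'rV[R]_d -> 'rV[R]_d)
  (x y : 'rV[R]_d).

(** The half-open box with half the edges lies in the set where the bump is
positive, and has positive volume. *)
Lemma bump_int_gt0 (a b : 'rV[R]_d) : (forall i, a 0 i < b 0 i) ->
  0 < \int[lam]_y box_bump a b y.
Proof.
move=> ab; rewrite lt0r Rintegral_ge0 ?andbT; last by move=> y _; exact: bump_ge0.
apply/negP => /eqP i0.
have mb : measurable_fun setT (box_bump a b).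
  exact: continuous_measurable_rV (Cclass_continuous (Cclass_bump a b)).
have ib : lam.-integrable setT (EFin \o box_bump a b).
  have := integrable_Cc (Cc0 (Cc_bump a b)) (loc_integrable_cst hlam 1).
  by under eq_fun do rewrite mulr1.
have : (\int[lam]_y `|(EFin \o box_bump a b) y| = 0)%E.
  under eq_integral do rewrite /= ger0_norm ?bump_ge0//.
  rewrite -[LHS]fineK; last exact: integrable_fin_num ib.
  by rewrite [X in X%:E]i0.
move/(ae_eq_integral_abs lam measurableT ((measurable_EFinP _ _).2 mb)).
move=> [N [mN N0 bN]].
pose c : 'rV[R]_d := \row_i ((a 0 i + b 0 i) / 2).
have ac i : a 0 i <= c 0 i by rewrite mxE; have := ab i; lra.
have : (lam (half_open_box a c) <= lam N)%E.
  apply: le_measure; rewrite ?inE//; first exact: half_open_box_measurable.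
  move=> x xac; apply: bN => /= /(_ I) [].
  apply/eqP/lt0r_neq0/bump_gt0 => i; have := xac i; rewrite mxE.
  by move=> /andP[-> /le_lt_trans]; apply; have := ab i; lra.
rewrite N0 hlam// leNgt lte_fin => /negP; apply.
by apply: prodr_gt0 => i _; rewrite mxE; have := ab i; lra.
Qed.

(** A nonnegative kernel supported in the cube of half-width 1 / (n + 1); the
normalization is left to the average. *)
Definition avg_kernel (n : nat) (y : 'rV[R]_d) : R :=
  box_bump (const_mx (- n.+1%:R^-1)) (const_mx n.+1%:R^-1) y.

Lemma Cc_kernel n : Cc 0 (avg_kernel n).
Proof. exact: Cc0 (Cc_bump _ _). Qed.

Definition kernel_mass n : R := \int[lam]_y avg_kernel n y.
Definition average n u x : R := (kernel_mass n)^-1 * mollify lam (avg_kernel n) u x.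

Lemma kernel_mass_gt0 n : 0 < kernel_mass n.
Proof.
by apply: bump_int_gt0 => i; rewrite !mxE gtrN// invr_gt0.
Qed.

Lemma average_bound n u x (M : R) : loc_integrable lam u ->
  (forall y, (forall i, `|y 0 i - x 0 i| <= n.+1%:R^-1) -> `|u y| <= M) ->
  `|average n u x| <= M.
Proof.
move=> lu uM; have k0 := kernel_mass_gt0 n; have Ck := Cc_kernel n.
rewrite /average normrM gtr0_norm ?invr_gt0// ler_pdivrMl//.
have -> : kernel_mass n * M = \int[lam]_y (avg_kernel n (y - x) * M).
  have ik : lam.-integrable setT (EFin \o (fun y => avg_kernel n (y - x))).
    have := loc_integrable_mollify_int x Ck (loc_integrable_cst hlam 1).
    by under eq_fun do rewrite mulr1.
  rewrite RintegralZr//; congr (_ * _).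
  by rewrite (Rintegral_shift hlam (- x) Ck).
have iku := loc_integrable_mollify_int x Ck lu.
apply: (le_trans (le_normr_Rintegral measurableT iku)).
apply: le_Rintegral => //.
- exact: integrable_norm.
- exact: loc_integrable_mollify_int x Ck (loc_integrable_cst hlam M).
move=> y _; rewrite normrM ger0_norm ?bump_ge0//.
have [h|h] := pselect (open_box (const_mx (- n.+1%:R^-1)) (const_mx n.+1%:R^-1) (y - x)).
  rewrite ler_wpM2l ?bump_ge0// uM// => i.
  by have := h i; rewrite !mxE ler_norml => /andP[/ltW -> /ltW ->].
by rewrite /avg_kernel bump_eq0// !mul0r.
Qed.

Lemma averageB n u (c : R) x : loc_integrable lam u ->
  average n (fun y => u y - c) x = average n u x - c.
Proof.
move=> lu; have k0 := kernel_mass_gt0 n; have Ck := Cc_kernel n.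
have lc := loc_integrable_cst hlam c.
rewrite /average /mollify.
under eq_Rintegral do rewrite mulrBr.
rewrite RintegralB//; try exact: loc_integrable_mollify_int.
have ik : lam.-integrable setT (EFin \o (fun y => avg_kernel n (y - x))).
  have := loc_integrable_mollify_int x Ck (loc_integrable_cst hlam 1).
  by under eq_fun do rewrite mulr1.
rewrite RintegralZr// (Rintegral_shift hlam (- x) Ck) mulrBr.
by rewrite [in X in _ - X]mulrA mulVf ?mul1r// lt0r_neq0.
Qed.

Lemma average_cvg u x : continuous u -> average n u x @[n --> \oo] --> u x.
Proof.
move=> cu; have lu := continuous_loc_integrable hlam cu.
apply/cvgrPdist_le => e e0.
have /(@cvgrPdist_le _ _ _ (nbhs (x : 'rV[R]_d)) _ u (u x))/(_ e e0) := cu x.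
move=> /nbhs_ballP[r r0 ur]; near=> n.
rewrite distrC -averageB//; apply: average_bound.
  by apply: loc_integrableB => //; exact: loc_integrable_cst.
move=> y yx; rewrite distrC; apply: ur; apply: ball_rV => // i.
rewrite distrC (le_lt_trans (yx i))//.
by near: n; exact: near_infty_natSinv_lt (PosNum r0).
Unshelve. all: by end_near. Qed.

Lemma Cclass_average n u : loc_integrable lam u -> Cclass 1 (average n u).
Proof. by move=> lu; apply/CclassZ/Cclass_mollify => //; exact/CcS/Cc_bump. Qed.

(** The divergence of the mollified field at x is the weak divergence of the
field tested against the avg_kernel centred at x. *)
Lemma div_average n j x : is_weak_div lam j (cst 0) ->
  div (fun y => \row_i average n (fun z => j z 0 i) y) x = 0.
Proof.
move=> [lj _ j0]; have Ck : Cc 1 (avg_kernel n) by exact/CcS/Cc_bump.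
have E i : partial i (fun y => (\row_k average n (fun z => j z 0 k) y) 0 i) x =
    - (kernel_mass n)^-1 * \int[lam]_y (partial i (avg_kernel n) (y - x) * j y 0 i).
  rewrite (_ : (fun y => _) = average n (fun z => j z 0 i)); last first.
    by apply/funext => y; rewrite mxE.
  rewrite partialZ; last exact: (@Cclass_derivable _ _ 0 _ i x (Cclass_mollify Ck (lj i))).
  by rewrite (mollify_partial i x Ck (lj i)) mulrN mulNr.
rewrite /div (eq_bigr _ (fun i _ => E i)) -big_distrr /=.
have -> : \sum_i \int[lam]_y (partial i (avg_kernel n) (y - x) * j y 0 i) =
    \int[lam]_y (dotv (j y) (grad (fun z => avg_kernel n (z - x)) y)).
  rewrite -Rintegral_sum => [|i]; last first.
    exact: loc_integrable_mollify_int (Cc0 (Cc_partial i Ck)) (lj i).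
  apply: eq_Rintegral => y _; apply: eq_bigr => i _.
  by rewrite mxE (partial_shift (avg_kernel n) i y (- x)) mulrC.
rewrite j0; last exact: Cc_shift.
by under eq_Rintegral do rewrite mul0r; rewrite /Rintegral integral0 /= oppr0 mulr0.
Qed.

(** A stationary field is antisymmetric as a first-order operator. As j is only
continuous, g j cannot be a test field for the weak gradient of f; the averages
of j against the kernels can, and they have divergence zero. *)
Lemma null_int_stationary j f G g :
  (forall i, continuous (fun x => j x 0 i)) -> is_weak_div lam j (cst 0) ->
  loc_integrable lam f -> (forall i, is_weak_partial lam i f (fun x => G x 0 i)) ->
  Cc 1 g ->
  null_int lam (fun x => f x * dotv (j x) (grad g x) + g x * dotv (j x) (G x)).
Proof.
move=> cj j0 lf fG Cg; have [K cK gK] := Cc_supp Cg.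
have lG i : loc_integrable lam (fun x => G x 0 i) by have [] := fG i.
have lj i := continuous_loc_integrable hlam (cj i).
pose J n x : 'rV[R]_d := \row_i average n (fun y => j y 0 i) x.
have CJ n i : Cclass 1 (fun x => J n x 0 i).
  by under eq_fun do rewrite mxE; exact: Cclass_average.
have nullF n : null_int lam
    (fun x => f x * dotv (J n x) (grad g x) + g x * dotv (J n x) (G x)).
  have CgJ i : Cc 1 (fun x => (g x *: J n x) 0 i).
    by under eq_fun do rewrite mxE; exact: CcM.
  have := null_int_weak_grad fG CgJ.
  congr null_int; apply/funext => x.
  rewrite (divZ x Cg.1 (CJ n)) (div_average n x j0) mulr0 add0r.
  by rewrite dotvZr (dotvC (grad g x)) (dotvC (G x)).
have [N N0 KN] := compact_sub_cube cK.
have [M [M0 jM]] : exists M, 0 <= M /\ forall i y, cube (N + 1) y -> `|j y 0 i| <= M.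
  have /choice[m mP] i : exists m, 0 <= m /\ forall y, cube (N + 1) y -> `|j y 0 i| <= m.
    have : compact ((fun y => j y 0 i) @` cube (N + 1)).
      apply: (continuous_compact (continuous_subspaceT (cj i))).
      exact: closed_box_compact.
    move=> /compact_bounded[m [_ mj]]; exists (`|m| + 1); split; first exact: addr_ge0.
    move=> y cy; apply: (mj (`|m| + 1)); last by exists y.
    by rewrite ltr_pwDr// ler_norm.
  exists (\sum_i m i); split; first by apply: sumr_ge0 => i _; exact: (mP i).1.
  move=> i y cy; rewrite (le_trans ((mP i).2 y cy))// (bigD1 i)//= lerDl.
  by apply: sumr_ge0 => k _; exact: (mP k).1.
have JM n i x : K x -> `|J n x 0 i| <= M.
  move=> /KN/cubeE Kx; rewrite mxE; apply: average_bound => // y yx.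
  apply: jM; apply/cubeE => k; rewrite -[y 0 k](subrK (x 0 k)).
  rewrite (le_trans (ler_normD _ _))// addrC lerD// (le_trans (yx k))//.
  by rewrite invf_le1 ?ltr0n ?ler1n.
pose H x := M * (\sum_i `|grad g x 0 i * f x| + \sum_i `|g x * G x 0 i|).
have iH : lam.-integrable setT (EFin \o H).
  have i1 i : lam.-integrable setT (EFin \o (fun x => `|grad g x 0 i * f x|)).
    have := integrable_Cc (Cc_partial_grad i Cg) lf.
    exact: integrable_norm.
  have i2 i : lam.-integrable setT (EFin \o (fun x => `|g x * G x 0 i|)).
    have := integrable_Cc (Cc0 Cg) (lG i); exact: integrable_norm.
  have := integrableD measurableT (integrable_Rsum i1) (integrable_Rsum i2).
  by move=> /(integrableZl measurableT M).
have gK' i x : ~ K x -> grad g x 0 i = 0.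
  move=> nK; rewrite mxE; apply: partial_supp nK => //.
  exact: (compact_closed (@norm_hausdorff R 'rV[R]_d) cK).
have FH n x : `|f x * dotv (J n x) (grad g x) + g x * dotv (J n x) (G x)| <= H x.
  rewrite (le_trans (ler_normD _ _))// /H mulrDr lerD//.
    rewrite /dotv big_distrr (le_trans (ler_norm_sum _ _ _))// big_distrr.
    apply: ler_sum => i _; have [Kx|nK] := pselect (K x); last first.
      by rewrite /= gK'// !(mul0r, mulr0, normr0).
    by rewrite /= mulrC -mulrA normrM ler_wpM2r// JM.
  rewrite /dotv big_distrr (le_trans (ler_norm_sum _ _ _))// big_distrr.
  apply: ler_sum => i _; have [Kx|nK] := pselect (K x); last first.
    by rewrite /= gK// !(mul0r, mulr0, normr0).
  by rewrite /= mulrCA normrM ler_wpM2r// JM.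
have cdot x w : dotv (J n x) w @[n --> \oo] --> dotv (j x) w.
  apply: cvg_big => [|i _]; first exact: add_continuous.
  apply: cvgM; last exact: cvg_cst.
  under eq_cvg do rewrite mxE; exact: average_cvg.
split.
  have i1 : lam.-integrable setT (EFin \o (fun x => f x * dotv (j x) (grad g x))).
    under eq_fun do rewrite mulrC; apply: integrable_Cc => //.
    by apply: Cc_dotv => [i|i]; [split|exact: Cc_partial_grad].
  have i2 : lam.-integrable setT (EFin \o (fun x => g x * dotv (j x) (G x))).
    under eq_fun do rewrite -dotvZl; apply: integrable_Cc_dotv => // i.
    under eq_fun do rewrite mxE; apply: CcM; first exact: Cc0 Cg.
    by split.
  by have := integrableD measurableT i1 i2.
have mF n : measurable_fun setT
    (fun x => f x * dotv (J n x) (grad g x) + g x * dotv (J n x) (G x)).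
  by apply/measurable_EFinP; exact: (measurable_int _ (nullF n).1).
have cF x : f x * dotv (J n x) (grad g x) + g x * dotv (J n x) (G x) @[n --> \oo] -->
    f x * dotv (j x) (grad g x) + g x * dotv (j x) (G x).
  by apply: cvgD; (apply: cvgM; [exact: cvg_cst|exact: cdot]).
have := real_dominated_convergence mF cF FH iH.
under eq_fun do rewrite (nullF _).2.
by move=> h; rewrite -(cvg_unique _ h (@cvg_cst _ _ _ _ _)).
Qed.

End averaging.

(** * Measures with a density *)

Section density.
Context {disp} {T : measurableType disp} {R : realType}
  (lam mu : {measure set T -> \bar R}) (p : T -> R).
Hypothesis mp : measurable_fun setT p.
Hypothesis p0 : forall x, 0 <= p x.
Hypothesis hmup : forall A : set T, measurable A ->
  mu A = (\int[lam]_(x in A) (p x)%:E)%E.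

Import HBNNSimple.

(* For a simple function this is the formula for the measure of its fibres. *)
Let nnsfun_density (h : {nnsfun T >-> R}) :
  (\int[mu]_x (h x)%:E = \int[lam]_x (h x * p x)%:E)%E.
Proof.
have mpre r : measurable (h @^-1` [set r]).
  by rewrite -[X in measurable X]setTI; exact: (measurable_funP h).
have hE x : (h x * p x)%:E =
    (\sum_(y \in range h) (y * \1_(h @^-1` [set y]) x * p x)%:E)%E.
  by rewrite fsumEFin// -mulr_fsuml -fimfunE.
under [RHS]eq_integral do rewrite hE.
rewrite ge0_integral_fsum//; last 2 first.
- move=> y; apply/measurable_EFinP; apply: measurable_funM => //.
  exact: measurable_funM.
- move=> y x _; rewrite lee_fin; have := nnfun_muleindic_ge0 h y x.
  by rewrite lee_fin => h0; exact: mulr_ge0.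
rewrite integralT_nnsfun sintegralE; apply: eq_fsbigr => r /[!inE] rh.
have r0 : 0 <= r by case: rh => x _ <-.
rewrite (hmup (mpre r)) [in LHS]integral_mkcond -ge0_integralZl//.
- apply: eq_integral => x _; rewrite epatch_indic /= -!EFinM; congr EFin; ring.
- apply/(measurable_restrictT _ (mpre r)).1; apply: measurable_funTS.
  exact: (measurable_EFinP setT p).2.
- by move=> x _; rewrite /patch; case: ifPn => // _; rewrite lee_fin.
Qed.

Lemma ge0_integral_density (f : T -> R) : measurable_fun setT f ->
  (forall x, 0 <= f x) -> (\int[mu]_x (f x)%:E = \int[lam]_x (f x * p x)%:E)%E.
Proof.
move=> mf f0; have mfE : measurable_fun setT (EFin \o f) by exact/measurable_EFinP.
pose h := nnsfun_approx measurableT mfE.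
have f0E x : setT x -> (0 <= (EFin \o f) x)%E by move=> _; rewrite lee_fin.
have hf x : (h n x)%:E @[n --> \oo] --> (f x)%:E.
  exact: (cvg_nnsfun_approx measurableT mfE f0E).
transitivity (limn (fun n => \int[mu]_x (h n x)%:E)%E).
  rewrite -monotone_convergence//.
  - by apply: eq_integral => x _; apply/esym/cvg_lim.
  - by move=> n; exact/measurable_EFinP.
  - by move=> n x _; rewrite lee_fin.
  - by move=> x _ m n mn; rewrite lee_fin; exact/lefP/nd_nnsfun_approx.
under eq_fun do rewrite nnsfun_density.
rewrite -monotone_convergence//.
- apply: eq_integral => x _; apply: cvg_lim => //.
  under eq_fun do rewrite EFinM; rewrite EFinM.
  by apply: cvgeZr.
- by move=> n; apply/measurable_EFinP; exact: measurable_funM.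
- by move=> n x _; rewrite lee_fin mulr_ge0.
- by move=> x _ m n mn; rewrite lee_fin ler_wpM2r//; exact/lefP/nd_nnsfun_approx.
Qed.

Lemma Rintegral_density (f : T -> R) : measurable_fun setT f ->
  \int[mu]_x f x = \int[lam]_x (f x * p x).
Proof.
move=> mf; congr fine; rewrite integralE [RHS]integralE.
have pos (g : T -> R) : measurable_fun setT g ->
    (\int[mu]_x maxe (g x)%:E 0 = \int[lam]_x maxe (g x * p x)%:E 0)%E.
  move=> mg; transitivity (\int[mu]_x (Num.max (g x) 0%R)%:E)%E.
    by apply: eq_integral => x _; rewrite EFin_max.
  rewrite ge0_integral_density.
  - by apply: eq_integral => x _; rewrite -EFin_max maxr_pMl// mul0r.
  - exact: measurable_maxr.
  - by move=> x; rewrite le_max lexx orbT.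
congr (_ - _)%E.
  transitivity (\int[mu]_x maxe (f x)%:E 0)%E.
    by apply: eq_integral => x _; rewrite unlock.
  by rewrite pos//; apply: eq_integral => x _; rewrite unlock.
transitivity (\int[mu]_x maxe (- f x)%:E 0)%E.
  by apply: eq_integral => x _; rewrite unlock.
rewrite (pos (fun x => - f x)); last exact: measurableT_comp.
by apply: eq_integral => x _; rewrite unlock mulNr.
Qed.

Lemma integrable_density (f : T -> R) : mu.-integrable setT (EFin \o f) ->
  lam.-integrable setT (EFin \o (fun x => f x * p x)).
Proof.
move=> /integrableP[/measurable_EFinP mf fi]; apply/integrableP; split.
  by apply/measurable_EFinP; exact: measurable_funM.
move: fi; under eq_integral do rewrite /= -abse_EFin.
rewrite (_ : (\int[mu]_x _)%E = (\int[lam]_x (`|f x| * p x)%:E)%E).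
  by under eq_integral do rewrite -[X in _ * X](ger0_norm (p0 _)) -normrM.
by apply: (@ge0_integral_density (fun x => `|f x|)) => //; exact: measurableT_comp.
Qed.

Lemma ae_density (P : T -> Prop) : {ae lam, forall x, P x} -> {ae mu, forall x, P x}.
Proof.
move=> [N [mN N0 PN]]; exists N; split => //.
rewrite [LHS](hmup mN) null_set_integral//.
by apply: measurable_funTS; exact/measurable_EFinP.
Qed.

End density.

(** * Symmetric and antisymmetric parts of a perturbed generator *)

Section perturbed_generator.
Context {R : realType} {d : nat} (lam : {measure set 'rV[R]_d -> \bar R})
  (mu : probability 'rV[R]_d R).
Variables (D : 'M[R]_d) (b : 'rV[R]_d -> 'rV[R]_d) (p : 'rV[R]_d -> R)
  (dom : set ('rV[R]_d -> R)) (q : 'rV[R]_d -> R) (W : 'rV[R]_d -> 'rV[R]_d).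
Hypothesis hlam : is_lebesgue lam.
Hypothesis symD : D^T = D.
Hypothesis cb : forall i, continuous (fun x => b x 0 i).
Hypothesis Cp : Cclass 1 p.
Hypothesis p0 : forall x, 0 < p x.
Hypothesis hmup : forall A : set 'rV[R]_d, measurable A ->
  mu A = (\int[lam]_(x in A) (p x)%:E)%E.
Hypothesis hj : is_weak_div lam (current D b p) (cst 0).
Hypothesis hdom : forall g, Cc 2 g -> dom g /\ diff_op_defined lam D g.
Hypothesis bq : loc_ess_bounded lam q.
Hypothesis CW : forall i, Cclass 1 (fun x => W x 0 i).
Implicit Types (f g h u : 'rV[R]_d -> R) (x : 'rV[R]_d).

(** In L^2(mu) the adjoint of 2 W . grad is - 2 W . grad - 2 weighted_div, which
is how this function enters both parts. *)
Definition weighted_div x : R := (p x)^-1 * div (fun y => p y *: W y) x.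

(** The common form of the two tilted generators. *)
Definition perturbed f x : R :=
  diff_op lam D b f x + q x * f x + 2 * dotv (W x) (wgrad lam f x).
Definition perturbed_sym f x : R :=
  sym_op lam D p f x + (q x - weighted_div x) * f x.
Definition perturbed_antisym f x : R :=
  antisym_op lam D b p f x + 2 * dotv (W x) (wgrad lam f x) + weighted_div x * f x.

Let p_neq0 x : p x != 0. Proof. exact: lt0r_neq0. Qed.
Let cp : continuous p. Proof. exact: Cclass_continuous Cp. Qed.
Let cpV : continuous (fun x => (p x)^-1). Proof. exact: continuous_V. Qed.
Let mp : measurable_fun setT p. Proof. exact: continuous_measurable_rV. Qed.
Let p_ge0 x : 0 <= p x. Proof. exact: ltW. Qed.

Let CpW i : Cclass 1 (fun x => (p x *: W x) 0 i).
Proof. by under eq_fun do rewrite mxE; exact: CclassM. Qed.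

Let c_weighted_div : continuous weighted_div.
Proof. apply: continuous_M => //; exact: Cclass_continuous (Cclass_div CpW). Qed.

Let c_current i : continuous (fun x => current D b p x 0 i).
Proof.
rewrite (_ : (fun x => _) = (fun x => p x * b x 0 i + (-1) * (grad p x *m D) 0 i)).
  apply: continuous_D; first exact: continuous_M.
  apply: continuous_M; first exact: cst_continuous.
  exact: Cclass_continuous (Cclass_mulmx D i (fun j => Cclass_grad j Cp)).
by apply/funext => x; rewrite !mxE mulN1r.
Qed.

Let c_velocity i : continuous (fun x => velocity D b p x 0 i).
Proof. by under eq_fun do rewrite mxE; exact: continuous_M. Qed.

Let cW i : continuous (fun x => W x 0 i).
Proof. exact: Cclass_continuous (CW i). Qed.

(** f p is integrable because mu is finite, and p^-1 is continuous. *)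
Lemma L2_loc_integrable f : L2 mu f -> loc_integrable lam f.
Proof.
move=> L2f; have mu1 : mu setT \is a fin_num by exact: fin_num_measure.
have /Lfun1_integrable/(integrable_density mp p_ge0 hmup) ifp := Lfun_subset12 mu1 L2f.
have lfp : loc_integrable lam (fun x => f x * p x).
  split; first by apply/measurable_EFinP; exact: measurable_int ifp.
  by move=> K cK; apply: integrableS ifp => //; exact: compact_measurable_rV.
have := loc_integrable_cont cpV lfp.
by congr loc_integrable; apply/funext => x; rewrite mulrCA mulVf ?mulr1.
Qed.

Let weak_grad f i : diff_op_defined lam D f ->
  is_weak_partial lam i f (fun x => wgrad lam f x 0 i).
Proof.
move=> [/(_ i)/weak_partialP + _]; congr is_weak_partial.
by apply/funext => x; rewrite mxE.
Qed.

Let weak_div_flux f : diff_op_defined lam D f ->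
  is_weak_div lam (fun x => wgrad lam f x *m D) (wdiv lam (fun x => wgrad lam f x *m D)).
Proof. by move=> [_ /wdivP]. Qed.

Let flux f x : 'rV[R]_d := p x *: (wgrad lam f x *m D).

Let weak_div_wflux f : diff_op_defined lam D f ->
  is_weak_div lam (flux f) (wdiv lam (flux f)).
Proof.
by move=> /weak_div_flux /(weak_divZ hlam Cp) h; apply: wdivP; eexists; exact: h.
Qed.

Let wdiv_flux f : diff_op_defined lam D f -> {ae lam, forall x,
  wdiv lam (flux f) x = p x * wdiv lam (fun x => wgrad lam f x *m D) x
    + dotv (wgrad lam f x *m D) (grad p x)}.
Proof.
move=> df; exact: (weak_div_uniq (weak_div_wflux df)
  (weak_divZ hlam Cp (weak_div_flux df))).
Qed.

Let loc_wgrad f i : diff_op_defined lam D f ->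
  loc_integrable lam (fun x => wgrad lam f x 0 i).
Proof. by move=> /(weak_grad i)[]. Qed.

(** The drift is the sum of the velocity and of the logarithmic gradient of the
density, which the weight p moves inside the divergence. *)
Lemma perturbed_sum f : diff_op_defined lam D f ->
  {ae lam, forall x, perturbed f x = perturbed_sym f x + perturbed_antisym f x}.
Proof.
move=> df; apply: filterS (wdiv_flux df) => x hx.
rewrite /perturbed /perturbed_sym /perturbed_antisym /sym_op -/(flux f) hx.
rewrite /antisym_op /velocity /current /diff_op.
rewrite dotvZl dotvDl dotvNl dotvZl (dotv_sym (wgrad lam f x) _ symD).
rewrite (dotvC (wgrad lam f x) (grad p x *m D)).
by field.
Qed.

Let loc_perturbed f : loc_integrable lam f -> diff_op_defined lam D f ->
  loc_integrable lam (perturbed f).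
Proof.
move=> lf df; apply: loc_integrableD; last first.
  apply: loc_integrableZ; apply: loc_integrable_dotv => // i; exact: loc_wgrad.
apply: loc_integrableD; last exact: loc_integrableM.
apply: loc_integrableD; first by apply: loc_integrable_dotv => // i; exact: loc_wgrad.
by have [] := weak_div_flux df.
Qed.

Let loc_diff f : loc_integrable lam f -> diff_op_defined lam D f ->
  loc_integrable lam (fun x => perturbed_sym f x - perturbed_antisym f x).
Proof.
move=> lf df; apply: loc_integrableB.
  apply: loc_integrableD.
    by apply: loc_integrable_cont => //; have [] := weak_div_wflux df.
  apply: loc_integrableM => //; apply: loc_ess_boundedD => //.
  apply: continuous_loc_ess_bounded.
  rewrite (_ : (fun x => - _) = (fun x => -1 * weighted_div x)).
    by apply: continuous_M => //; exact: cst_continuous.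
  by apply/funext => x; rewrite mulN1r.
apply: loc_integrableD; last exact: loc_integrable_cont.
apply: loc_integrableD.
  by apply: loc_integrable_dotv => // i; exact: loc_wgrad.
by apply: loc_integrableZ; apply: loc_integrable_dotv => // i; exact: loc_wgrad.
Qed.

Let classical g x : R := dotv (b x) (grad g x) + div (fun y => grad g y *m D) x
  + 2 * dotv (W x) (grad g x).

Let Cc_classical g : Cc 2 g -> Cc 0 (classical g).
Proof.
move=> Cg; apply: CcD; first apply: CcD.
- by apply: Cc_dotv => [i|i]; [split|exact: Cc_partial_grad (CcS Cg)].
- by apply: Cc_div => i; apply: Cc_mulmx => j; exact: Cc_partial_grad.
- apply: CcMl; first exact: Cclass_cst.
  by apply: Cc_dotv => [i|i]; [split|exact: Cc_partial_grad (CcS Cg)].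
Qed.

(** The classical derivatives of a test function are weak derivatives, and these
are unique up to null sets. *)
Lemma perturbed_test g : Cc 2 g ->
  {ae lam, forall x, perturbed g x = classical g x + q x * g x}.
Proof.
move=> Cg; have [_ dg] := hdom Cg; have Cg1 := Cclass1 Cg.1.
have eg i : {ae lam, forall x, wgrad lam g x 0 i = grad g x 0 i}.
  have h : is_weak_partial lam i g (fun x => grad g x 0 i).
    have := Cclass_weak_partial hlam i Cg1.
    by congr is_weak_partial; apply/funext => x; rewrite mxE.
  exact: (weak_partial_uniq (weak_grad i dg) h).
have egr : {ae lam, forall x, wgrad lam g x = grad g x}.
  have h : {ae lam, forall x i, wgrad lam g x 0 i = grad g x 0 i}.
    exact: (filter_forall _ eg).
  by apply: filterS h => x h; apply/rowP.
have ediv : {ae lam, forall x, wdiv lam (fun y => wgrad lam g y *m D) x =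
    div (fun y => grad g y *m D) x}.
  have CgD i : Cclass 1 (fun x => (grad g x *m D) 0 i).
    by apply: Cclass_mulmx => j; exact: Cclass_grad Cg.1.
  suff h : is_weak_div lam (fun y => wgrad lam g y *m D) (div (fun y => grad g y *m D)).
    exact: (weak_div_uniq (weak_div_flux dg) h).
  have [_ ldiv ibp] := Cclass_weak_div hlam CgD.
  have [lG _ _] := weak_div_flux dg.
  split => // phi Cphi; rewrite -ibp//; apply: Rintegral_ae_eq.
  - have h : loc_integrable lam (fun x => dotv (grad phi x) (wgrad lam g x *m D)).
      apply: loc_integrable_dotv => // i.
      by apply: Cclass_continuous; exact: (Cclass_grad i Cphi.1).
    by under eq_fun do rewrite dotvC; exact: h.1.
  - apply: continuous_measurable_rV.
    apply: (@Cclass_continuous _ _ 0); apply: Cclass_dotv => i.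
      exact: CclassS (CgD i).
    exact: Cclass_grad Cphi.1.
  - by apply: filterS egr => x ->.
apply: filterS2 egr ediv => x e1 e2.
by rewrite /perturbed /diff_op e1 e2 /classical addrAC.
Qed.

(** The difference of the two sides is the integral of a sum n of four functions
with vanishing integrals. *)
Lemma perturbed_ibp f : loc_integrable lam f -> diff_op_defined lam D f ->
  ibp_adjoint lam mu perturbed f (fun x => perturbed_sym f x - perturbed_antisym f x).
Proof.
move=> lf df; have lh := loc_diff lf df; split => // g Cg.
set h := fun x => _ - _ in lh *.
have [dg ddg] := hdom Cg; have Cg1 := CcS Cg; have lg : loc_integrable lam g.
  exact/continuous_loc_integrable/(Cclass_continuous Cg.1).
have lTg := loc_perturbed lg ddg.
rewrite !(Rintegral_density mp p_ge0 hmup); last 2 first.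
- by apply: measurable_funM; [exact: lg.1|exact: lh.1].
- by apply: measurable_funM; [exact: lTg.1|exact: lf.1].
have wG i := weak_grad i df.
have CgD i : Cc 1 (fun x => (grad g x *m D) 0 i).
  by apply: Cc_mulmx => j; exact: Cc_partial_grad.
have n1 := null_int_stationary hlam c_current hj lf wG Cg1.
have C1 i : Cc 1 (fun x => (p x *: (grad g x *m D)) 0 i).
  by under eq_fun do rewrite mxE; exact: CcMl.
have n2 := null_int_weak_grad wG C1.
have n3 := null_intZ (-1) (null_int_weak_div (weak_div_wflux df) Cg1).
have C2 i : Cc 1 (fun x => (g x *: (p x *: W x)) 0 i).
  by under eq_fun do rewrite mxE; apply: CcM.
have n4 := null_intZ 2 (null_int_weak_grad wG C2).
have n := null_intD (null_intD n1 n2) (null_intD n3 n4).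
apply: (null_int_eq _ _ n).
- by apply: measurable_funM => //; apply: measurable_funM; [exact: lTg.1|exact: lf.1].
- have := integrable_Cc (Cc0 Cg) (loc_integrable_cont cp lh).
  congr (lam.-integrable _ (EFin \o _)); apply/funext => x.
  by rewrite mulrA mulrAC.
apply: filterS (perturbed_test Cg) => x ->.
rewrite (divZ x Cp (fun i => (CgD i).1)) (divZ x Cg1.1 CpW).
rewrite /classical /h /perturbed_sym /perturbed_antisym /sym_op -/(flux f).
rewrite /antisym_op /velocity /weighted_div /flux /current.
set dv := div (fun y => p y *: W y) x; set H := wdiv _ _ x.
set G := wgrad lam f x; set g' := grad g x; set p' := grad p x.
rewrite !(dotvZl, dotvZr, dotvDl, dotvNl).
rewrite (dotvC G (g' *m D)) !(dotv_sym g' _ symD) !(dotv_sym p' _ symD).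
rewrite (dotvC (G *m D) g') (dotvC g' (W x)) (dotvC G (W x)).
by field.
Qed.

Lemma ibp_adjoint_uniq T f h h' : ibp_adjoint lam mu T f h ->
  ibp_adjoint lam mu T f h' -> {ae lam, forall x, h x = h' x}.
Proof.
move=> [lh ih] [lh' ih'].
have : {ae lam, forall x, p x * h x = p x * h' x}.
  apply: ae_eq_of_test => //; try exact: loc_integrable_cont.
  move=> phi Cphi; have cphi := Cclass_continuous Cphi.1.
  have mphi := continuous_measurable_rV cphi.
  have E u : loc_integrable lam u ->
      \int[lam]_x (p x * u x * phi x) = \int[mu]_x (phi x * u x).
    move=> lu; rewrite (Rintegral_density mp p_ge0 hmup); last first.
      by apply: measurable_funM => //; exact: lu.1.
    by apply: eq_Rintegral => x _; ring.
  by rewrite !E// -ih// ih'.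
by apply: filterS => x /(mulfI (p_neq0 x)).
Qed.

Let perturbed_test_L2 g : Cc 2 g -> L2 mu (perturbed g).
Proof.
move=> Cg; have [dg ddg] := hdom Cg.
have lg : loc_integrable lam g.
  exact/continuous_loc_integrable/(Cclass_continuous Cg.1).
have lTg := loc_perturbed lg ddg.
have [M1 M10 clM] := Cc_bounded (Cc_classical Cg).
have [M2 M20 gM] := Cc_bounded Cg.
have [K cK gK] := Cc_supp Cg; have [M3 M30 qM] := bq.2 K cK.
have bT : {ae mu, forall x, `|perturbed g x| <= M1 + M3 * M2}.
  apply: (ae_density mp hmup); apply: filterS2 (perturbed_test Cg) qM => x -> qx.
  rewrite (le_trans (ler_normD _ _))// lerD// normrM.
  have [Kx|nK] := pselect (K x); first by rewrite ler_pM// qx.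
  by rewrite gK// normr0 mulr0 mulr_ge0// ltW.
have C0 : 0 <= M1 + M3 * M2 by rewrite addr_ge0// ?mulr_ge0// ltW.
rewrite /L2 inE; apply/andP; split; rewrite inE /=; first exact: lTg.1.
rewrite /finite_norm unlock poweR_lty//.
apply: (@le_lt_trans _ _ (\int[mu]_x (((M1 + M3 * M2) `^ 2)%:E))%E).
  apply: ae_ge0_le_integral => //.
  - by move=> x _; exact: poweR_ge0.
  - apply/measurable_EFinP.
    apply: (@measurableT_comp _ _ _ _ _ _ (fun t : R => t `^ 2)) => //.
    by apply: measurableT_comp => //; exact: lTg.1.
  - by move=> x _; rewrite lee_fin powR_ge0.
  - apply: filterS bT => x hx _; rewrite /= lee_fin.
    by apply: ge0_ler_powR; rewrite ?nnegrE.
rewrite integral_cst// lte_mul_pinfty ?lee_fin ?powR_ge0//.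
by rewrite -ge0_fin_numE// fin_num_measure.
Qed.

(** Test functions belong to the domain and have square-integrable images, so
they are among the functions against which the Hilbert space adjoint is
tested. *)
Lemma adjoint_ibp_adjoint f h :
  adjoint mu (L2_graph mu dom perturbed) f h -> ibp_adjoint lam mu perturbed f h.
Proof.
move=> [L2f L2h fh]; split; first exact: L2_loc_integrable.
move=> g Cg; apply: fh; split; first by have [] := hdom Cg.
  exact: perturbed_test_L2.
exact: aeW.
Qed.

(** The operator gives S + A, and every adjoint is almost everywhere equal to
S - A, by the integration by parts and uniqueness. *)
Lemma perturbed_has_parts f : L2 mu f -> diff_op_defined lam D f ->
  has_parts lam mu dom perturbed f (perturbed_sym f) (perturbed_antisym f).
Proof.
move=> L2f df; have lf := L2_loc_integrable L2f.
have ibp := perturbed_ibp lf df.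
split; first by exists (fun x => perturbed_sym f x - perturbed_antisym f x).
move=> h hh; have {hh} ibph : ibp_adjoint lam mu perturbed f h.
  by case: hh => // /adjoint_ibp_adjoint.
have e1 := ae_density mp hmup (ibp_adjoint_uniq ibph ibp).
have e2 := ae_density mp hmup (perturbed_sum df).
by split; apply: filterS2 e1 e2 => x -> ->; field.
Qed.

End perturbed_generator.

(** * The tilted generators *)

Section coefficients.
Context {R : realType} {d : nat} (lam : {measure set 'rV[R]_d -> \bar R}).

Lemma lipschitz_coord_continuous (b : 'rV[R]_d -> 'rV[R]_d) i :
  (exists K : R, K.-lipschitz b) -> continuous (fun x => b x 0 i).
Proof.
move=> [K Kb] x.
apply/(@cvgrPdist_lt _ _ _ (nbhs (x : 'rV[R]_d)) _ (fun y => b y 0 i) (b x 0 i)) => e e0.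
have K0 : 0 < `|K| + 1 by rewrite ltr_pwDr.
apply/nbhs_ballP; exists (e / (`|K| + 1)); first exact: divr_gt0.
move=> y; rewrite mx_norm_ball /ball_ /= => xy.
have := Kb (x, y) (conj I I) => /= bxy.
have := le_trans (le_coord_norm (b x - b y) i) bxy; rewrite !mxE => h.
apply: (le_lt_trans h); rewrite ltr_pdivlMr// in xy.
apply: le_lt_trans xy; rewrite mulrC ler_wpM2l//.
by rewrite (le_trans (ler_norm _))// lerDl.
Qed.

Lemma Linfty_loc_ess_bounded (V : 'rV[R]_d -> R) :
  V \in Lfun lam +oo%E -> loc_ess_bounded lam V.
Proof.
rewrite inE => /andP[/[!inE] /= mV]; rewrite /finite_norm unlock => fV.
split => // K cK.
have [M VM] : exists M : R, {ae lam, forall x, `|V x| <= M}.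
  move: fV; case: ifPn => [_|]; last first.
    rewrite -leNgt measure_le0 => /eqP l0 _; exists 0.
    by exists setT; split.
  exact: (@ess_supr_bounded _ _ _ lam (Num.norm \o V)).
exists `|M| => //; apply: filterS VM => x VM _.
by rewrite (le_trans VM)// ler_norm.
Qed.

End coefficients.

Theorem proposition3p3 (R : realType) (d m : nat)
    (lam : {measure set 'rV[R]_d -> \bar R}) (hlam : is_lebesgue lam)
    (* the diffusion *)
    (dO : measure_display) (Om : measurableType dO) (P : probability Om R)
    (B : R -> Om -> 'rV[R]_m) (hB : is_brownian P B)
    (b : 'rV[R]_d -> 'rV[R]_d) (hb : exists K : R, K.-lipschitz b)
    (sigma : 'M[R]_(d, m)) (hsigma : positive_definite (sigma *m sigma^T))
    (D : 'M[R]_d) (hD : D = 2^-1 *: (sigma *m sigma^T))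
    (X : 'rV[R]_d -> R -> Om -> 'rV[R]_d) (hX : is_diffusion P b sigma B X)
    (* its invariant measure *)
    (mu : probability 'rV[R]_d R) (hmu : unique_invariant P X mu)
    (p : 'rV[R]_d -> R) (hp : smooth p) (hp0 : forall x, 0 < p x)
    (hmup : forall A : set 'rV[R]_d, measurable A ->
       mu A = (\int[lam]_(x in A) (p x)%:E)%E)
    (hj : is_weak_div lam (current D b p) (cst 0))
    (* the generator in L^2(mu) of the transition semigroup *)
    (hsc : strongly_continuous mu (transition P X))
    (hgen : acts_as_diff_op lam D b (generator mu (transition P X)))
    (hcore : exists C : set ('rV[R]_d -> R),
       [/\ is_core mu (generator mu (transition P X)) C,
           is_core mu (adjoint mu (generator mu (transition P X))) C &
           forall c : R, C (cst c)])
    (V : 'rV[R]_d -> R) (hV : V \in Lfun lam +oo%E)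
    (U : 'rV[R]_d -> 'rV[R]_d) (hU : forall i, Cb1 (fun x => U x 0 i))
    (k : R) (f : 'rV[R]_d -> R)
    (hf : domain (generator mu (transition P X)) f) :
  has_parts lam mu (domain (generator mu (transition P X)))
    (tilted_rho lam D b V k) f
    (fun x => sym_op lam D p f x + k * V x * f x)
    (fun x => antisym_op lam D b p f x) /\
  has_parts lam mu (domain (generator mu (transition P X)))
    (tilted_J lam D b U k) f
    (fun x => sym_op lam D p f x
       + k * dotv (velocity D b p x) (U x) * f x
       + k ^+ 2 * dotv (U x) (U x *m D) * f x)
    (fun x => antisym_op lam D b p f x
       + 2 * k * dotv (U x *m D) (wgrad lam f x)
       + k * ((p x)^-1 * div (fun y => p y *: (U y *m D)) x) * f x).

Proof.
have symD : D^T = D by rewrite hD linearZ /= trmx_mul trmxK.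
have cb i : continuous (fun x => b x 0 i) by exact: lipschitz_coord_continuous.
have Cp : Cclass 1 p by exact: hp.
have hdom g : Cc 2 g -> domain (generator mu (transition P X)) g /\
    diff_op_defined lam D g.
  by move=> Cg; have [h gh] := hgen.1 g Cg; split; [exists h|exact: (hgen.2 _ _ gh).1].
have [h fh] := hf; have [L2f _ _] := fh; have [df _] := hgen.2 _ _ fh.
have CU i : Cclass 1 (fun x => U x 0 i) by have [] := hU i.
have CUD i : Cclass 1 (fun x => (U x *m D) 0 i) by exact: Cclass_mulmx.
split.
(* The potential alone: W = 0. *)
- have bV : loc_ess_bounded lam (fun x => k * V x).
    apply: loc_ess_boundedM; last exact: Linfty_loc_ess_bounded.
    by apply: continuous_loc_ess_bounded; exact: cst_continuous.
  have C0 (i : 'I_d) : Cclass 1 (fun x : 'rV[R]_d => (0 : 'rV[R]_d) 0 i).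
    by rewrite mxE; exact: Cclass_cst.
  have div0 x : weighted_div p (fun=> 0) x = 0.
    rewrite /weighted_div (divZ x Cp C0) dotvC dotv0l addr0.
    rewrite /div big1 ?mulr0// => i _; rewrite mxE; exact: derive_cst.
  have := perturbed_has_parts hlam symD cb Cp hp0 hmup hj hdom bV C0 L2f df.
  congr has_parts; first apply/funext => g; apply/funext => x.
  + by rewrite /perturbed dotv0l mulr0 addr0.
  + by rewrite /perturbed_sym div0 subr0.
  + by rewrite /perturbed_antisym div0 dotv0l mulr0 mul0r !addr0.
(* The current: W = k D U. *)
have bq : loc_ess_bounded lam (fun x => k * (dotv (b x) (U x) + div (fun y => U y *m D) x)
    + k ^+ 2 * dotv (U x) (U x *m D)).
  apply: continuous_loc_ess_bounded; apply: (@Cclass_continuous _ _ 0).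
  have CU0 i := CclassS (CU i); have CUD0 i := CclassS (CUD i).
  apply: CclassD; apply: CclassZ; last exact: Cclass_dotv.
  by apply: CclassD; [apply: Cclass_dotv => // i; split|exact: Cclass_div].
have CW i : Cclass 1 (fun x => (k *: (U x *m D)) 0 i).
  by under eq_fun do rewrite mxE; exact: CclassZ.
have := perturbed_has_parts hlam symD cb Cp hp0 hmup hj hdom bq CW L2f df.
have divW x : weighted_div p (fun y => k *: (U y *m D)) x =
    k * ((p x)^-1 * div (fun y => p y *: (U y *m D)) x).
  rewrite /weighted_div mulrCA; congr (_ * _).
  rewrite (_ : (fun y => _) = (fun y => k *: (p y *: (U y *m D)))); last first.
    by apply/funext => y; rewrite !scalerA mulrC.
  rewrite (divZ (n := 0) (m := 0)); last 2 first.
  - exact: Cclass_cst.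
  - by move=> i; under eq_fun do rewrite mxE; exact: CclassM.
  have -> : grad (fun _ : 'rV[R]_d => k) x = 0.
    by apply/rowP => i; rewrite !mxE; exact: derive_cst.
  by rewrite dotv0l addr0.
congr has_parts; first apply/funext => g; apply/funext => x.
- rewrite /perturbed /tilted_J dotvZl (dotv_sym _ _ symD); ring.
- rewrite /perturbed_sym divW (divZ x Cp CUD) /velocity /current.
  rewrite dotvZl dotvDl dotvNl dotvZl (dotv_sym _ _ symD).
  by field; exact: lt0r_neq0.
- by rewrite /perturbed_antisym divW dotvZl; ring.
Qed.
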